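(* Let $n\ge 2$ be an integer, and let $1<p_1,p_2\le\infty$ and $1<p\le\infty$ satisfy $\frac1{p_1}+\frac1{p_2}=\frac1p$. Then the bilinear spherical maximal operator $\mathcal M$ maps $L^{p_1}(\mathbb R^n)\times L^{p_2}(\mathbb R^n)$ to $L^p(\mathbb R^n)$; that is, there is a finite constant $C$ (depending on $n,p_1,p_2$) such that $$\|\mathcal M(f,g)\|_{L^p(\mathbb R^n)}\le C\,\|f\|_{L^{p_1}(\mathbb R^n)}\,\|g\|_{L^{p_2}(\mathbb R^n)}$$ for all Schwartz functions $f,g$ on $\mathbb R^n$.
   Context: For Schwartz functions $f,g$ on $\mathbb R^n$, the bi(sub)linear spherical maximal function is $$\mathcal M(f,g)(x)=\sup_{t>0}\Big|\int_{\mathbb S^{2n-1}} f(x-ty)\,g(x-tz)\,d\sigma(y,z)\Big|,\qquad x\in\mathbb R^n,$$ where $\mathbb S^{2n-1}=\{(y,z)\in\mathbb R^n\times\mathbb R^n: |y|^2+|z|^2=1\}$ and $\sigma$ is surface measure on $\mathbb S^{2n-1}$. Here $1/\infty=0$. *)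

(* Defs.v *)
From HB Require Import structures.
From mathcomp Require Import all_boot all_order all_algebra.
From mathcomp Require Import complex.
From mathcomp Require Import all_classical all_reals all_analysis.
From mathcomp Require Import measurable_realfun.

Set Implicit Arguments.
Unset Strict Implicit.
Unset Printing Implicit Defensive.

Import Order.TTheory GRing.Theory Num.Theory.
Import numFieldNormedType.Exports.

Local Open Scope classical_set_scope.
Local Open Scope ring_scope.

Definition measure_rV_display : measure_display.
Proof. exact: default_measure_display. Qed.

Section measurable_rV.
Context {R : realType} (n : nat).

(* The sigma-algebra generated by the coordinates, as for n.-tuple R; it is the
   Borel sigma-algebra of the (sup-norm) topology of 'rV[R]_n. *)
Let coord_rV : 'I_n -> 'rV[R]_n -> R := fun i v => v ord0 i.

Let rV_set0 : g_sigma_preimage coord_rV set0.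
Proof. exact: sigma_algebra0. Qed.

Let rV_setC A : g_sigma_preimage coord_rV A -> g_sigma_preimage coord_rV (~` A).
Proof. exact: sigma_algebraC. Qed.

Let rV_bigcup (F : _^nat) : (forall i, g_sigma_preimage coord_rV (F i)) ->
  g_sigma_preimage coord_rV (\bigcup_i (F i)).
Proof. exact: sigma_algebra_bigcup. Qed.

HB.instance Definition _ := @isMeasurable.Build measure_rV_display
  'rV[R]_n (g_sigma_preimage coord_rV) rV_set0 rV_setC rV_bigcup.

Lemma measurable_coord_rV (i : 'I_n) :
  measurable_fun [set: 'rV[R]_n] (fun v : 'rV[R]_n => v ord0 i).
Proof.
move=> _ Y mY; rewrite setTI; apply: sub_sigma_algebra => /=.
rewrite -bigcup_seq/=; exists i => /=; first by rewrite mem_index_enum.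
by exists Y => //; rewrite setTI.
Qed.

Lemma measurable_fun_rV d (T : measurableType d) (f : T -> 'rV[R]_n) :
  (forall i, measurable_fun [set: T] (fun x => f x ord0 i)) ->
  measurable_fun [set: T] f.
Proof.
move=> mf _ A mA; rewrite setTI.
suff /(_ _ mA) :
  g_sigma_preimage coord_rV `<=` [set B | measurable (f @^-1` B)] by [].
apply: smallest_sub.
  split=> [|B|F] /=.
  - by rewrite preimage_set0; exact: measurable0.
  - by move=> mB; rewrite setTD -preimage_setC; exact: measurableC.
  - by move=> mF; rewrite preimage_bigcup; exact: bigcupT_measurable.
move=> B; rewrite -bigcup_seq => -[i _ [C mC <-]] /=.
by rewrite setTI -comp_preimage -[X in measurable X]setTI; exact: mf.
Qed.

End measurable_rV.

(* The library's sigma-finite instance on product measures is not inferred: the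
   one for subprobabilities takes precedence. *)
Lemma sigma_finite_product d1 d2 (T1 : measurableType d1)
    (T2 : measurableType d2) (R : realType)
    (m1 : {sigma_finite_measure set T1 -> \bar R})
    (m2 : {sigma_finite_measure set T2 -> \bar R}) :
  sigma_finite setT (m1 \x m2)%E.
Proof.
have /sigma_finiteP[F [TF ndF Foo]] := sigma_finiteT m1.
have /sigma_finiteP[G [TG ndG Goo]] := sigma_finiteT m2.
exists (fun k => F k `*` G k).
  rewrite -setXTT TF TG predeqE => -[x y]; split.
    move=> [/= [i _ Fix] [j _ Gjy]]; exists (maxn i j) => //; split.
    - by move: x Fix; exact/subsetPset/ndF/leq_maxl.
    - by move: y Gjy; exact/subsetPset/ndG/leq_maxr.
  by move=> [i _ []/= ? ?]; split; exists i.
move=> k; have [? ?] := Foo k; have [? ?] := Goo k.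
split; first exact: measurableX.
by rewrite product_measure1E// lte_mul_pinfty// ge0_fin_numE.
Qed.

Section lebesgue_rV.
Context {R : realType}.

Section cons.
Variable n : nat.

Definition cons_rV (p : measurableTypeR R * 'rV[R]_n) : 'rV[R]_n.+1 :=
  row_mx (p.1 : R)%:M p.2 : 'rV[R]_(1 + n).

Lemma cons_rV0 p : cons_rV p ord0 ord0 = p.1.
Proof.
have E : ord0 = lshift n ord0 :> 'I_(1 + n) by exact/val_inj.
apply: etrans (congr1 (cons_rV p ord0) E) _; apply: etrans (row_mxEl _ _ _ _) _.
by rewrite mxE eqxx mulr1n.
Qed.

Lemma cons_rVS p i : cons_rV p ord0 (lift ord0 i) = p.2 ord0 i.
Proof.
have E : lift ord0 i = rshift 1 i :> 'I_(1 + n) by exact/val_inj.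
by apply: etrans (congr1 (cons_rV p ord0) E) _; exact: row_mxEr.
Qed.

Lemma measurable_cons_rV :
  measurable_fun [set: measurableTypeR R * 'rV[R]_n] cons_rV.
Proof.
apply: measurable_fun_rV => i; have [j ->|->] := unliftP ord0 i.
  under eq_fun do rewrite cons_rVS.
  exact: measurableT_comp (measurable_coord_rV j) measurable_snd.
by under eq_fun do rewrite cons_rV0; exact: measurable_fst.
Qed.

Definition uncons_rV (v : 'rV[R]_n.+1) : measurableTypeR R * 'rV[R]_n :=
  (lsubmx (v : 'rV[R]_(1 + n)) ord0 ord0, rsubmx (v : 'rV[R]_(1 + n))).

Lemma cons_rVK : cancel cons_rV uncons_rV.
Proof.
move=> [x v]; rewrite /cons_rV /uncons_rV/= row_mxKl row_mxKr.
by rewrite mxE eqxx mulr1n.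
Qed.

Lemma measurable_uncons_rV : measurable_fun [set: 'rV[R]_n.+1] uncons_rV.
Proof.
apply: measurable_fun_pair.
  by under eq_fun do rewrite mxE; exact: measurable_coord_rV.
apply: measurable_fun_rV => i.
by under eq_fun do rewrite mxE; exact: measurable_coord_rV.
Qed.

Variable mu : {sigma_finite_measure set 'rV[R]_n -> \bar R}.

Definition lebesgue_cons : set 'rV[R]_n.+1 -> \bar R :=
  pushforward (@lebesgue_measure R \x mu)%E cons_rV.

Let lebesgue_cons0 : lebesgue_cons set0 = 0%E.
Proof. by rewrite /lebesgue_cons /pushforward preimage_set0 measure0. Qed.

Let lebesgue_cons_ge0 A : (0 <= lebesgue_cons A)%E.
Proof. by rewrite /lebesgue_cons /pushforward measure_ge0. Qed.

Let lebesgue_cons_sigma_additive : semi_sigma_additive lebesgue_cons.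
Proof.
exact: (@measure_semi_sigma_additive _ _ _
  (measure_function_pushforward__canonical__measure_function_Measure
    (@lebesgue_measure R \x mu)%E measurable_cons_rV)).
Qed.

HB.instance Definition _ := isMeasure.Build _ _ _ lebesgue_cons
  lebesgue_cons0 lebesgue_cons_ge0 lebesgue_cons_sigma_additive.

Let lebesgue_cons_sigma_finite : sigma_finite setT lebesgue_cons.
Proof.
have [F TF mF] := sigma_finite_product (@lebesgue_measure R) mu.
exists (fun k => uncons_rV @^-1` F k).
  by rewrite -preimage_bigcup -TF preimage_setT.
move=> k; have [mFk Fkoo] := mF k; split.
  by rewrite -[X in measurable X]setTI; exact: measurable_uncons_rV.
rewrite /lebesgue_cons /pushforward -comp_preimage.
by rewrite (_ : _ \o _ = id) ?preimage_id//; apply/funext; exact: cons_rVK.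
Qed.

HB.instance Definition _ := Measure_isSigmaFinite.Build _ _ _ lebesgue_cons
  lebesgue_cons_sigma_finite.

End cons.

Fixpoint lebesgue_rV (n : nat) : {sigma_finite_measure set 'rV[R]_n -> \bar R} :=
  if n is n'.+1 then lebesgue_cons (lebesgue_rV n')
  else @dirac _ _ (0 : 'rV[R]_0) R.

Lemma measurable_box_rV n (A : 'I_n -> set R) :
  (forall i, measurable (A i)) ->
  measurable [set v : 'rV[R]_n | forall i, A i (v ord0 i)].
Proof.
move=> mA; rewrite (_ : mkset _ =
    \big[setI/setT]_(i < n) ((fun v : 'rV[R]_n => v ord0 i) @^-1` A i)).
  apply: bigsetI_measurable => i _; rewrite -[X in measurable X]setTI.
  exact: measurable_coord_rV.
rewrite -bigcap_seq; apply/seteqP; split=> v /= Av i; first by move=> _; exact: Av.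
by apply: (Av i); rewrite /= mem_index_enum.
Qed.

Lemma lebesgue_rV_box n (A : 'I_n -> set R) :
  (forall i, measurable (A i)) ->
  lebesgue_rV n [set v | forall i, A i (v ord0 i)] =
  (\prod_(i < n) @lebesgue_measure R (A i))%E.
Proof.
elim: n A => [|n IHn] A mA /=.
  by rewrite big_ord0 diracE mem_set// => -[].
rewrite big_ord_recl -(IHn (fun i => A (lift ord0 i)))//.
pose B := [set v : 'rV[R]_n | forall i, A (lift ord0 i) (v ord0 i)].
have mB : measurable B.
  by apply: (@measurable_box_rV n (fun i => A (lift ord0 i))) => i; exact: mA.
rewrite -(product_measure1E (@lebesgue_measure R) _ (mA ord0) mB).
rewrite /lebesgue_cons /pushforward; congr (_ _); apply/seteqP; split=> -[x v] /=.
  move=> Axv; split=> [|i].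
    by have := Axv ord0; rewrite cons_rV0.
  by have := Axv (lift ord0 i); rewrite cons_rVS.
move=> [Ax Av] i; have [j ->|->] := unliftP ord0 i.
  by rewrite cons_rVS; exact: Av.
by rewrite cons_rV0.
Qed.

End lebesgue_rV.

Section sphere.
Context {R : realType} (n : nat).
Local Notation T := ('rV[R]_n * 'rV[R]_n)%type.

Definition sqnorm_rV (v : 'rV[R]_n) : R := \sum_(i < n) v ord0 i ^+ 2.

Definition pair_sqnorm (u : T) : R := sqnorm_rV u.1 + sqnorm_rV u.2.

Definition sphere : set T := [set u | pair_sqnorm u = 1].

Definition punctured_ball : set T := [set u | 0 < pair_sqnorm u <= 1].

Definition sphere_proj (u : T) : T :=
  let r := Num.sqrt (pair_sqnorm u) in (r^-1 *: u.1, r^-1 *: u.2).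

Lemma measurable_pair_sqnorm : measurable_fun [set: T] pair_sqnorm.
Proof.
apply: measurable_funD; apply: measurable_sum => i; apply: measurable_funX.
  exact: measurableT_comp (measurable_coord_rV i) measurable_fst.
exact: measurableT_comp (measurable_coord_rV i) measurable_snd.
Qed.

Lemma measurable_punctured_ball : measurable punctured_ball.
Proof.
rewrite (_ : punctured_ball = pair_sqnorm @^-1` `]0, 1]); last first.
  by apply/seteqP; split=> u /=; rewrite in_itv.
by rewrite -[X in measurable X]setTI; exact: measurable_pair_sqnorm.
Qed.

Lemma measurable_sphere_proj : measurable_fun [set: T] sphere_proj.
Proof.
have mr : measurable_fun [set: T] (fun u => (Num.sqrt (pair_sqnorm u))^-1).
  under eq_fun do rewrite -powR_inv1 ?sqrtr_ge0//.
  apply: (@measurableT_comp _ _ _ _ _ _ (@powR R ^~ (-1)) _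
    (fun u => Num.sqrt (pair_sqnorm u))); first exact: measurable_powR.
  apply: (@measurableT_comp _ _ _ _ _ _ (@Num.sqrt R)) measurable_pair_sqnorm.
  exact: continuous_measurable_fun (@sqrt_continuous R).
apply: measurable_fun_pair; apply: measurable_fun_rV => i;
  under eq_fun do rewrite mxE; apply: measurable_funM => //.
  exact: measurableT_comp (measurable_coord_rV i) measurable_fst.
exact: measurableT_comp (measurable_coord_rV i) measurable_snd.
Qed.

(* sigma(A) = 2n |{r w : w \in A, 0 < r <= 1}|, which is the surface measure
   by the polar coordinates formula du = r^(2n-1) dr dsigma(w) in R^(2n); as a
   measure on the ambient space it is carried by the sphere. *)
Definition surface_measure (A : set T) : \bar R :=
  ((n.*2)%:R%:E * (lebesgue_rV n \x lebesgue_rV n)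
                    (sphere_proj @^-1` A `&` punctured_ball))%E.

Let nu : {measure set T -> \bar R} :=
  measure_function_pushforward__canonical__measure_function_Measure
    (mrestr (lebesgue_rV n \x lebesgue_rV n)%E measurable_punctured_ball)
    measurable_sphere_proj.

Let surface_measure0 : surface_measure set0 = 0%E.
Proof. exact: (measure0 (mscale (n.*2)%:R%:nng nu)). Qed.

Let surface_measure_ge0 A : (0 <= surface_measure A)%E.
Proof. exact: (measure_ge0 (mscale (n.*2)%:R%:nng nu)). Qed.

Let surface_measure_sigma_additive : semi_sigma_additive surface_measure.
Proof.
exact: (@measure_semi_sigma_additive _ _ _ (mscale (n.*2)%:R%:nng nu)).
Qed.

HB.instance Definition _ := isMeasure.Build _ _ _ surface_measure
  surface_measure0 surface_measure_ge0 surface_measure_sigma_additive.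

Lemma surface_measure_setC_sphere : surface_measure (~` sphere) = 0%E.
Proof.
rewrite /surface_measure (_ : _ `&` _ = set0) ?measure0 ?mule0//.
apply/seteqP; split=> // -[y z] [/= + /andP[+ _]] => nS u0; apply: nS.
have sqnormZ (c : R) v : sqnorm_rV (c *: v) = c ^+ 2 * sqnorm_rV v.
  by rewrite /sqnorm_rV mulr_sumr; apply: eq_bigr => i _; rewrite mxE exprMn.
rewrite /sphere/= /sphere_proj/= [LHS]/pair_sqnorm/= !sqnormZ -mulrDr.
by rewrite exprVn sqr_sqrtr ?(ltW u0)// mulVf// gt_eqF.
Qed.

End sphere.
Arguments sphere {R} n.
Arguments surface_measure {R} n.

Section schwartz.
Context {R : realType} (n : nat).

(* For smooth f the order of the indices in s is irrelevant. *)
Definition iter_partial (s : seq 'I_n) (f : 'rV[R]_n -> R) : 'rV[R]_n -> R :=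
  foldr (fun i g => 'D_(delta_mx 0 i) g) f s.

Definition smooth_rV (f : 'rV[R]_n -> R) : Prop :=
  forall s : seq 'I_n, continuous (iter_partial s f) /\
    forall i x, derivable (iter_partial s f) x (delta_mx 0 i).

Definition monomial_rV (a : 'I_n -> nat) (x : 'rV[R]_n) : R :=
  \prod_(i < n) x ord0 i ^+ a i.

Definition real_schwartz (f : 'rV[R]_n -> R) : Prop :=
  smooth_rV f /\
  forall (a : 'I_n -> nat) (s : seq 'I_n), exists C : R,
    forall x, `|monomial_rV a x * iter_partial s f x| <= C.

(* Derivatives are only available for maps into a normed module over R, hence
   the componentwise definition. *)
Definition schwartz (f : 'rV[R]_n -> R[i]) : Prop :=
  real_schwartz (fun x => complex.Re (f x)) /\
  real_schwartz (fun x => complex.Im (f x)).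

End schwartz.

Section complex_integral.
Context d (T : measurableType d) {R : realType}.

Definition Cintegral (mu : {measure set T -> \bar R}) (D : set T)
    (F : T -> R[i]) : R[i] :=
  Complex (\int[mu]_(u in D) complex.Re (F u))
          (\int[mu]_(u in D) complex.Im (F u)).

Definition CLnorm (mu : {measure set T -> \bar R}) (p : \bar R)
    (f : T -> R[i]) : \bar R :=
  Lnorm mu p (fun x => (ComplexField.Normc.normc (f x))%:E).

End complex_integral.

Definition spherical_maximal {R : realType} (n : nat) (f g : 'rV[R]_n -> R[i])
    (x : 'rV[R]_n) : \bar R :=
  ereal_sup [set (ComplexField.Normc.normc
    (Cintegral (surface_measure n) (sphere n)
      (fun u => f (x - t *: u.1) * g (x - t *: u.2))))%:E | t in `]0, +oo[].

(* Main.v *)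
Require Import Defs.
From mathcomp Require Import all_boot all_order all_algebra.
From mathcomp Require Import complex.
From mathcomp Require Import all_classical all_reals all_analysis.
From mathcomp Require Import measurable_realfun ess_sup_inf ring lra.

(* Slicing the sphere, the projection of sigma to either factor of R^n x R^n has
   a density proportional to (1 - |y|^2)^((n-2)/2) on the unit ball, which is
   bounded because n >= 2. Hence for h >= 0 the averages of h(x - ty) over the
   sphere are dominated by the Hardy-Littlewood maximal function of h at x. Given
   1/p1 + 1/p2 = 1/p, put r = p1/p and r' = p2/p, so that 1/r + 1/r' = 1; Young's
   inequality |f||g| <= |f|^r + |g|^r' (after normalizing f and g) bounds M(f,g)
   pointwise by the maximal functions of |f|^r and |g|^r', which are bounded on
   L^p since p > 1. No interpolation is needed.

   The density bound is obtained without polar coordinates: by homogeneity sigma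
   is a multiple of the image of Lebesgue measure on the thin shell
   s < |u|^2 <= 1, the fibres of the shell over the first factor are annuli of
   volume O(1 - s), and s tends to 1.

   The maximal function is the increasing limit of maxima over finitely many
   cubes with rational data; such a maximum is bounded with bounded support, so
   its L^p norm is finite and can be absorbed. *)

Set Implicit Arguments.
Unset Strict Implicit.
Unset Printing Implicit Defensive.

Import Order.TTheory GRing.Theory Num.Theory.
Import numFieldNormedType.Exports.
Import ComplexField.Normc.

Local Open Scope classical_set_scope.
Local Open Scope ring_scope.

(** * Lebesgue measure on row vectors *)

Section lebesgue_rV.
Context {R : realType}.
Implicit Types n : nat.

(** Cubes replace Euclidean balls because Lebesgue measure is built here as a product and the
    topology is that of the sup norm: volumes are explicit, and tripling a cube costs exactly $3^n$.
    Countably many cubes make the maximal function measurable. Measurability of $\mathcal M(f,g)$, a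
    supremum over all $t>0$, is never established; its norm is bounded through a measurable majorant
    of its $q$-th power. The condition $n\ge 2$ acts through the Lipschitz continuity of $c\mapsto
    c^{n/2}$ on $[0,1]$, which bounds the volume of every fibre of the shell by $O(1-s)$ uniformly
    in the base point. A shell of fixed thickness controls only solid averages; continuity of the
    averaged function turns these into sphere averages as $s\to 1$, so the powers of $|f|$ and $|g|$
    have to be continuous. The condition $p>1$ acts through the ratio $2^{p-1}>1$ of the geometric
    series over dyadic levels. Normalization fails for norms $0$ and $\infty$, and $r$ or $r'$ is
    infinite together with $p_1$ or $p_2$. These cases are separate; a function with infinite
    exponent is replaced by its supremum. *)

Definition cube n (c : 'rV[R]_n) (r : R) : set 'rV[R]_n :=
  [set v | forall i, `|v ord0 i - c ord0 i| < r].

Lemma cube_box n (c : 'rV[R]_n) r :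
  cube c r = [set v | forall i, ball (c ord0 i) r (v ord0 i)].
Proof.
by apply/seteqP; split=> v /= cv i; have := cv i; rewrite /ball/= distrC.
Qed.

Lemma measurable_cube n (c : 'rV[R]_n) r : measurable (cube c r).
Proof.
rewrite cube_box; apply: (@measurable_box_rV R n (fun i => ball (c ord0 i) r)).
by move=> i; exact: measurable_ball.
Qed.

Lemma lebesgue_cube n (c : 'rV[R]_n) r : 0 <= r ->
  lebesgue_rV n (cube c r) = ((r *+ 2) ^+ n)%:E.
Proof.
move=> r0; rewrite cube_box.
rewrite (@lebesgue_rV_box R n (fun i => ball (c ord0 i) r)); last first.
  by move=> i; exact: measurable_ball.
under eq_bigr do rewrite lebesgue_measure_ball//.
by rewrite prodEFin prodr_const card_ord.
Qed.

(** Boxes form a generating family stable under intersection, and the cubes of half-side [k] exhaust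
    the space with finite measure. The scaling law of Lebesgue measure is deduced from this
    uniqueness. *)
Lemma lebesgue_rV_unique n (m : {measure set 'rV[R]_n -> \bar R}) :
  (forall A : 'I_n -> set R, (forall i, measurable (A i)) ->
    m [set v | forall i, A i (v ord0 i)] =
    (\prod_(i < n) @lebesgue_measure R (A i))%E) ->
  forall X, measurable X -> lebesgue_rV n X = m X.
Proof.
move=> mE X mX.
pose box (A : 'I_n -> set R) := [set v : 'rV[R]_n | forall i, A i (v ord0 i)].
pose G := [set B | exists2 A : 'I_n -> set R, (forall i, measurable (A i)) &
  B = box A].
apply: (measure_unique G (fun k => cube 0 k%:R)) => //.
- apply/seteqP; split; last first.
    apply: smallest_sub; first exact: sigma_algebra_measurable.
    by move=> _ [A mA ->]; exact: measurable_box_rV.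
  apply: smallest_sub; first exact: smallest_sigma_algebra.
  move=> B; rewrite -bigcup_seq => -[i _ [C mC <-]].
  apply: sub_sigma_algebra; exists (fun j => if j == i then C else setT).
    by move=> j; case: ifP.
  apply/seteqP; split=> v /=.
    by move=> [_ Cv] j; case: eqP => // ->.
  by move=> /(_ i); rewrite eqxx.
- move=> _ _ [A mA ->] [B mB ->]; exists (fun i => A i `&` B i).
    by move=> i; exact: measurableI.
  apply/seteqP; split=> v /=; first by move=> [Av Bv] i; split; [exact: Av|exact: Bv].
  by move=> AB; split=> i; have [] := AB i.
- move=> k; exists (fun=> ball 0 k%:R); first by move=> i; exact: measurable_ball.
  by rewrite cube_box; apply/seteqP; split=> v /= + i => /(_ i); rewrite mxE.
- apply/seteqP; split=> // v _.
  exists (\max_(i < n) Num.truncn `|v ord0 i|).+1 => // i; rewrite mxE subr0.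
  apply: lt_le_trans (truncnS_gt _) _; rewrite ler_nat ltnS.
  exact: (leq_bigmax i).
- by move=> _ [A mA ->]; rewrite mE//; exact: lebesgue_rV_box.
- move=> k; apply: le_lt_trans (ltry ((k%:R *+ 2) ^+ n)).
  by rewrite le_eqVlt; apply/orP; left; apply/eqP; exact: lebesgue_cube.
Qed.

Lemma measurable_affine (x t : R) :
  measurable_fun [set: measurableTypeR R]
    (fun y : measurableTypeR R => x + t * y : measurableTypeR R).
Proof.
by apply: measurable_funD => //; apply: measurable_funM.
Qed.

Lemma lebesgue_measure_affine (x t : R) (A : set R) : t != 0 -> measurable A ->
  (`|t|%:E * @lebesgue_measure R ((fun y => (x + t * y)%R) @^-1` A) =
  @lebesgue_measure R A)%E.
Proof.
move=> t0 mA; apply/esym.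
pose m : {measure set (measurableTypeR R) -> \bar R} := mscale (NngNum (normr_ge0 t))
  (measure_function_pushforward__canonical__measure_function_Measure
    (@lebesgue_measure R) (@measurable_affine x t)).
rewrite -[RHS]/(m A).
apply: (lebesgue_measure_unique (mu := m)) => //= _ [[a b]] _ <-.
rewrite /m /mscale/= /pushforward.
have [tp|tn|] := ltgtP 0 t; last by move=> /esym/eqP; rewrite (negbTE t0).
- rewrite (_ : _ @^-1` _ = `](a - x) / t, (b - x) / t]%classic); last first.
    by apply/seteqP; split=> y; rewrite /= !in_itv/= ltr_pdivrMr// ler_pdivlMr//;
      rewrite ltrBlDl lerBrDl mulrC.
  rewrite !lebesgue_measure_itv/= !lte_fin ltr_pM2r ?invr_gt0// ltrD2r.
  case: ifPn => _; last by rewrite mule0.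
  rewrite gtr0_norm// -!EFinB -EFinM; congr EFin; field; exact: lt0r_neq0.
(* A negative [t] reverses the order, so the preimage of []a, b]] is closed on the left and open on
   the right. *)
- rewrite (_ : _ @^-1` _ = `[(b - x) / t, (a - x) / t[%classic); last first.
    by apply/seteqP; split=> y; rewrite /= !in_itv/= ltr_ndivlMr// ler_ndivrMr//;
      rewrite ltrBlDl lerBrDl mulrC andbC.
  rewrite !lebesgue_measure_itv/= !lte_fin ltr_nM2r ?invr_lt0// ltrD2r.
  case: ifPn => _; last by rewrite mule0.
  rewrite ltr0_norm// -!EFinB -EFinM; congr EFin; field; exact: ltr0_neq0.
Qed.

Lemma measurable_affine_rV n (x : 'rV[R]_n) (t : R) :
  measurable_fun [set: 'rV[R]_n] (fun y => x + t *: y).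
Proof.
apply: measurable_fun_rV => i; under eq_fun do rewrite !mxE.
by apply: measurable_funD => //; apply: measurable_funM => //; exact: measurable_coord_rV.
Qed.

Lemma lebesgue_affine_rV n (x : 'rV[R]_n) (t : R) A : t != 0 -> measurable A ->
  ((`|t| ^+ n)%:E * lebesgue_rV n ((fun y => (x + t *: y)%R) @^-1` A) =
  lebesgue_rV n A)%E.
Proof.
move=> t0 mA; apply/esym.
pose m : {measure set 'rV[R]_n -> \bar R} :=
  mscale (NngNum (exprn_ge0 n (normr_ge0 t)))
  (measure_function_pushforward__canonical__measure_function_Measure
    (lebesgue_rV n) (@measurable_affine_rV n x t)).
rewrite -[RHS]/(m A).
apply: (lebesgue_rV_unique (m := m)) => //= B mB.
rewrite /m /mscale/= /pushforward.
pose C i := (fun y => x ord0 i + t * y) @^-1` B i.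
have mC i : measurable (C i).
  by rewrite -[C i]setTI; exact: (@measurable_affine (x ord0 i) t measurableT _ (mB i)).
have E : (fun y => x + t *: y) @^-1` [set v | forall i, B i (v ord0 i)] =
    [set v : 'rV[R]_n | forall i, C i (v ord0 i)].
  by apply/seteqP; split=> v /= + i => /(_ i); rewrite /C /= !mxE.
apply: etrans (congr1 (fun S => (_ * lebesgue_rV n S)%E) E) _.
rewrite (lebesgue_rV_box mC).
rewrite -{1}(card_ord n) -prodr_const -prodEFin -big_split/=.
by apply: eq_bigr => i _; rewrite lebesgue_measure_affine.
Qed.

Lemma ge0_integral_affine_rV n (x : 'rV[R]_n) (t : R) A (h : 'rV[R]_n -> \bar R) :
  t != 0 -> measurable A -> measurable_fun setT h -> (forall y, 0 <= h y)%E ->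
  (\int[lebesgue_rV n]_(y in A) h y = (`|t| ^+ n)%:E *
   \int[lebesgue_rV n]_(y in (fun y => (x + t *: y)%R) @^-1` A) h (x + t *: y)%R)%E.
Proof.
move=> t0 mA mh h0.
pose m : {measure set 'rV[R]_n -> \bar R} :=
  mscale (NngNum (exprn_ge0 n (normr_ge0 t)))
  (measure_function_pushforward__canonical__measure_function_Measure
    (lebesgue_rV n) (@measurable_affine_rV n x t)).
rewrite (eq_measure_integral m); last first.
  by move=> B mB _; exact/esym/lebesgue_affine_rV.
rewrite ge0_integral_mscale//; last exact: measurable_funTS.
rewrite ge0_integral_pushforward//; last exact: measurable_funTS.
exact: measurable_affine_rV.
Qed.

(* The absolute value only serves to make every radius nonnegative. *)
Definition rat_ball n (k : nat) : 'rV[R]_n * R :=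
  let q := odflt (0, 0) (unpickle k : option ('rV[rat]_n * rat)%type) in
  (map_mx ratr q.1, `|ratr q.2|).

Definition rat_cube n (k : nat) : set 'rV[R]_n :=
  cube (rat_ball n k).1 (rat_ball n k).2.

Lemma measurable_rat_cube n k : measurable (@rat_cube n k).
Proof. exact: measurable_cube. Qed.

(** The window for the radius makes the rational cube contain [cube x t] (two displacements below
    [t] stay below [2 t]) while its volume is at most [(6 t) ^ n]. Passing to countably many cubes
    thus costs only a dimensional factor. *)
Lemma rat_cube_approx n (x : 'rV[R]_n) (t : R) : 0 < t ->
  exists k, 2 * t < (rat_ball n k).2 < 3 * t /\
    forall i, `|x ord0 i - (rat_ball n k).1 ord0 i| < t.
Proof.
move=> t0.
have /choice[c cx] : forall i, exists q : rat, `|x ord0 i - ratr q| < t.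
  move=> i; have /rat_in_itvoo[q] : x ord0 i - t < x ord0 i + t by lra.
  by rewrite in_itv/= -ltr_distl distrC; exists q.
have /rat_in_itvoo[r] : 2 * t < 3 * t by lra.
rewrite in_itv/= => rt.
exists (pickle (\row_i c i, r)); rewrite /rat_ball pickleK/=.
split=> [|i]; last by rewrite !mxE.
by rewrite ger0_norm//; lra.
Qed.

(** The sigma-algebra is generated by the coordinates, so an open set is exhibited as the countable
    union of the rational cubes that it contains. *)
Lemma open_measurable_rV n (U : set 'rV[R]_n) : open U -> measurable U.
Proof.
move=> oU.
rewrite (_ : U = \bigcup_k (if pselect (@rat_cube n k `<=` U) then @rat_cube n k else set0)).
  apply: bigcupT_measurable => k; case: pselect => //= _.
  exact: measurable_rat_cube.
apply/seteqP; split=> [x Ux|x [k _]]; last first.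
  by case: pselect => //= + xk; exact.
have /nbhs_ballP[e/= e0 eU] : nbhs x U by exact: oU.
(* The radius is below [3 e / 4] and the centre within [e / 4] of [x], so the whole cube lies within
   [e] of [x]. *)
have [k [/andP[r1 r2] xc]] := @rat_cube_approx n x (e / 4) (divr_gt0 e0 (ltr0Sn _ _)).
exists k => //; case: pselect => [/= _ i|/=].
  by apply: lt_trans (xc i) _; lra.
apply => v cv; apply: eU; split=> // i j; rewrite (ord1 i) /ball/=.
apply: le_lt_trans (ler_distD ((rat_ball n k).1 0 j) _ _) _.
by rewrite [`|_ - v 0 j|]distrC; have := cv j; have := xc j; lra.
Qed.

Lemma continuous_measurable_rV n (f : 'rV[R]_n -> R) :
  continuous f -> measurable_fun setT f.
Proof.
move=> /continuousP cf; apply: (measurability _ (RGenOpens.measurableE R)).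
move=> _ [_ [a [b ->] <-]]; rewrite setTI; apply: open_measurable_rV.
by apply: cf; exact: interval_open.
Qed.

End lebesgue_rV.
Arguments rat_cube {R} n k.

Section integral_extra.
Context d (T : measurableType d) {R : realType}.
Variable mu : {measure set T -> \bar R}.

(* Unlike [ge0_le_integral], no measurability is needed: the integral of a
   nonnegative function is a supremum over the simple functions below it. *)
Lemma ge0_le_integral_nonmeasurable (f g : T -> \bar R) :
  (forall x, 0 <= f x)%E -> (forall x, f x <= g x)%E ->
  (\int[mu]_x f x <= \int[mu]_x g x)%E.
Proof.
move=> f0 fg; rewrite !ge0_integralTE//; last first.
  by move=> x; exact: le_trans (f0 x) (fg x).
apply: le_ereal_sup => _ [s sf <-]; exists s => // x.
exact: le_trans (sf x) (fg x).
Qed.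

End integral_extra.

(** * From weak type to strong type *)

Section dyadic_layers.
Context {R : realType}.
Implicit Types (u d p q : R) (N : nat).

(** One term suffices: the largest level below [u] is at least [u / 2]. *)
Lemma powR_le_dyadic_sum u d p N : 0 < d -> 0 < p -> d < u <= d * 2 ^+ N ->
  u `^ p <= 2 `^ p * \sum_(i < N) (d * 2 ^+ i) `^ p * (d * 2 ^+ i < u)%R%:R.
Proof.
move=> d0 p0; elim: N => [|N IH].
  by rewrite expr0 mulr1 => /andP[/lt_le_trans /[apply]]; rewrite ltxx.
move=> /andP[du uN]; rewrite big_ord_recr/= mulrDr.
have s0 : 0 <= \sum_(i < N) (d * 2 ^+ i) `^ p * (d * 2 ^+ i < u)%R%:R.
  by apply: sumr_ge0 => i _; rewrite mulr_ge0// powR_ge0.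
have [Nu|uN'] := ltP (d * 2 ^+ N) u; last first.
  by rewrite mulr0 mulr0 addr0 IH// du.
rewrite mulr1 -powRM//; last by rewrite mulr_ge0 ?ltW// exprn_ge0.
apply: le_trans (_ : (2 * (d * 2 ^+ N)) `^ p <= _); last first.
  by rewrite lerDr mulr_ge0// powR_ge0.
have u0 : 0 < u := lt_trans d0 du.
apply: ge0_ler_powR; rewrite ?nnegrE ?mulr_ge0 ?exprn_ge0 ?(ltW p0) ?(ltW d0) ?(ltW u0)//.
by rewrite mulrCA -exprS.
Qed.

Lemma powR2_gt1 q : 0 < q -> 1 < 2 `^ q :> R.
Proof.
move=> q0; rewrite -[ltLHS](powRr0 2) /powR pnatr_eq0/= ltr_expR mul0r.
by rewrite mulr_gt0// ln_gt0// ltr1n.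
Qed.

(** The constant is the one that closes the induction: [K = (2^q - 1)^-1] satisfies [K + 1 = K 2^q].
    Positivity of [q] is what makes the top term dominate. *)
Lemma dyadic_geometric_sum d q N : 0 < d -> 0 < q ->
  \sum_(i < N) (d * 2 ^+ i) `^ q <= (2 `^ q - 1)^-1 * (d * 2 ^+ N) `^ q.
Proof.
move=> d0 q0; have q1 := powR2_gt1 q0.
elim: N => [|N IH].
  by rewrite big_ord0 mulr_ge0 ?powR_ge0// invr_ge0; lra.
rewrite big_ord_recr/= (le_trans (lerD IH (lexx _)))//.
rewrite exprS mulrCA [in leRHS]powRM//; last by rewrite mulr_ge0 ?ltW// exprn_ge0.
set a := (d * 2 ^+ N) `^ q; set b := 2 `^ q in q1 *.
rewrite le_eqVlt; apply/orP; left; apply/eqP; field; lra.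
Qed.

(** If the top level lies below [u], the indicators are bounded by 1 and the geometric sum is
    controlled by its top term; otherwise that term vanishes and the induction hypothesis applies.
    The bound is uniform in the number of levels. *)
Lemma dyadic_sum_le_powR u d q N : 0 < d -> 0 < q -> 0 <= u ->
  \sum_(i < N) (d * 2 ^+ i) `^ q * (d * 2 ^+ i < u)%R%:R <=
  (2 `^ q - 1)^-1 * 2 `^ q * u `^ q.
Proof.
move=> d0 q0 u0; have q1 := powR2_gt1 q0.
have K0 : 0 <= (2 `^ q - 1 : R)^-1 by rewrite invr_ge0; lra.
elim: N => [|N IH].
  by rewrite big_ord0 !mulr_ge0 ?powR_ge0.
rewrite big_ord_recr/=; have [Nu|_] := ltP (d * 2 ^+ N) u; last first.
  by rewrite mulr0 addr0.
have dN0 : 0 <= d * 2 ^+ N by rewrite mulr_ge0 ?ltW// exprn_ge0.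
apply: le_trans (_ : \sum_(i < N.+1) (d * 2 ^+ i) `^ q <= _).
  rewrite big_ord_recr/= mulr1 lerD2r; apply: ler_sum => i _.
  by rewrite ler_piMr ?powR_ge0// lern1 leq_b1.
apply: le_trans (dyadic_geometric_sum _ d0 q0) _.
rewrite -mulrA ler_wpM2l// exprS mulrCA powRM// ler_wpM2l ?powR_ge0//.
by apply: ge0_ler_powR; rewrite ?nnegrE ?(ltW q0) ?(ltW Nu).
Qed.

(** The larger of [u] and [B h] decides which of the two terms alone dominates the product. *)
Lemma young_weighted (h u B p : R) : 0 <= h -> 0 <= u -> 0 < B -> 1 < p ->
  h * u `^ (p - 1) <= B^-1 * u `^ p + B `^ (p - 1) * h `^ p.
Proof.
move=> h0 u0 B0 p1.
have [Bhu|uBh] := leP (B * h) u.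
  apply: le_trans (_ : B^-1 * u `^ p <= _); last first.
    by rewrite lerDl mulr_ge0 ?powR_ge0.
  rewrite -(@mulr_powRB1 _ u p)//; last by lra.
  by rewrite mulrA ler_wpM2r ?powR_ge0// mulrC ler_pdivlMr// mulrC.
apply: le_trans (_ : B `^ (p - 1) * h `^ p <= _); last first.
  by rewrite lerDr mulr_ge0 ?powR_ge0// invr_ge0 ltW.
rewrite -(@mulr_powRB1 _ h p)//; last by lra.
rewrite mulrCA ler_wpM2l// -powRM ?(ltW B0)//.
have Bh0 : 0 <= B * h by rewrite mulr_ge0// ltW.
by apply: ge0_ler_powR; rewrite ?nnegrE ?(ltW uBh)//; lra.
Qed.

End dyadic_layers.

Definition maximal_const {R : realType} (p A : R) : R :=
  2 * (2 `^ p * A * ((2 `^ (p - 1) - 1)^-1 * 2 `^ (p - 1))).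

Section strong_type.
Context d0 (T : measurableType d0) {R : realType}.
Variable mu : {measure set T -> \bar R}.

Lemma ge0_integral_indicl (g : T -> R) (E : set T) :
  measurable E -> (\int[mu]_(x in E) (g x)%:E = \int[mu]_x (g x * \1_E x)%:E)%E.
Proof.
move=> mE; rewrite -[in LHS](setTI E) integral_mkcondr.
apply: eq_integral => x _; rewrite patchE indicE.
by case: (x \in E); rewrite ?mulr1 ?mulr0.
Qed.

(* With q = p - 1 and K from dyadic_sum_le_powR, slicing phi at the levels
   c_i = d 2^i and summing the weak type bounds gives
   int phi^p <= (B / 2) int h phi^q, where B = 2 (2^p A K) = maximal_const p A;
   the last integral is at most B^-1 int phi^p + B^q int h^p by Young, and half of
   the finite quantity int phi^p is absorbed. *)
Lemma strong_type_of_weak_type (phi h : T -> R) (A p d : R) (N : nat) :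
  measurable_fun setT phi -> measurable_fun setT h ->
  (forall x, 0 <= phi x) -> (forall x, 0 <= h x) ->
  0 < A -> 1 < p -> 0 < d ->
  (forall x, phi x = 0 \/ d < phi x <= d * 2 ^+ N) ->
  (forall c, 0 < c -> (c%:E * mu [set x | (c < phi x)%R] <=
     A%:E * \int[mu]_(x in [set x | (c < phi x)%R]) (h x)%:E)%E) ->
  (\int[mu]_x (phi x `^ p)%:E < +oo)%E ->
  (\int[mu]_x (phi x `^ p)%:E <=
   (maximal_const p A `^ p)%:E * \int[mu]_x (h x `^ p)%:E)%E.
Proof.
move=> mphi mh phi0 h0 A0 p1 d_gt0 phiE weak phifin.
have p0 : 0 < p by lra.
have q0 : 0 < p - 1 by lra.
set q := p - 1 in q0 *.
have q1 := powR2_gt1 q0.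
pose K := (2 `^ q - 1 : R)^-1 * 2 `^ q.
have K0 : 0 < K by rewrite mulr_gt0 ?powR_gt0// invr_gt0; lra.
have -> : maximal_const p A = 2 * (2 `^ p * A * K) by [].
set B := 2 * _; have B0 : 0 < B.
  by do 3 apply: mulr_gt0 => //; exact: powR_gt0.
pose c (i : 'I_N) := d * 2 ^+ i.
have c0 i : 0 < c i by rewrite mulr_gt0 ?exprn_gt0.
pose E i := [set x | c i < phi x].
have mE i : measurable (E i).
  rewrite (_ : E i = phi @^-1` `]c i, +oo[); last first.
    by apply/seteqP; split=> x; rewrite /= in_itv/= andbT.
  by rewrite -[X in measurable X]setTI; exact: mphi.
have EE i x : \1_(E i) x = (c i < phi x)%R%:R :> R.
  by rewrite indicE; congr ((nat_of_bool _)%:R); apply/idP/idP; rewrite inE.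
have m1E i : measurable_fun setT (\1_(E i) : T -> R) by exact: measurable_indic.
have mpow r (f : T -> R) : measurable_fun setT f -> measurable_fun setT (fun x => f x `^ r).
  by move=> mf; apply: measurableT_comp (measurable_powR _) mf.
have S1 : (\int[mu]_x (phi x `^ p)%:E <=
    (2 `^ p)%:E * \sum_(i < N) (c i `^ p)%:E * mu (E i))%E.
  apply: le_trans (_ : (\int[mu]_x ((2 `^ p)%:E *
      \sum_(i < N) ((c i `^ p)%:E * (\1_(E i) x)%:E)) <= _)%E).
    apply: ge0_le_integral => //.
    - by move=> x _; rewrite lee_fin powR_ge0.
    - by apply/measurable_EFinP; exact: mpow.
    - apply: emeasurable_funM => //; apply: emeasurable_sum => i.
      by apply: emeasurable_funM => //; exact/measurable_EFinP.
    - move=> x _; under eq_bigr do rewrite -EFinM EE; rewrite sumEFin -EFinM lee_fin.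
      have [->|/powR_le_dyadic_sum] := phiE x; last exact.
      rewrite powR0 ?gt_eqF// mulr_ge0 ?powR_ge0//.
      by apply: sumr_ge0 => i _; rewrite mulr_ge0 ?powR_ge0.
  rewrite ge0_integralZl_EFin ?powR_ge0//; last 2 first.
  - by move=> x _; apply: sume_ge0 => i _; rewrite mule_ge0// lee_fin powR_ge0.
  - by apply: emeasurable_sum => i; apply: emeasurable_funM => //; exact/measurable_EFinP.
  rewrite ge0_integral_sum//; last 2 first.
  - by move=> i; apply: emeasurable_funM => //; exact/measurable_EFinP.
  - by move=> i x _; rewrite mule_ge0// lee_fin powR_ge0.
  rewrite le_eqVlt; apply/orP; left; apply/eqP; congr (_ * _)%E; apply: eq_bigr => i _.
  rewrite ge0_integralZl_EFin ?powR_ge0//; last exact/measurable_EFinP.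
  by rewrite integral_indic// setIT.
(* One factor of [(c i)^p] is spent on the weak type bound, the remaining [(c i)^q] is kept for the
   summation over levels. *)
have S2 i : ((c i `^ p)%:E * mu (E i) <= A%:E * ((c i `^ q)%:E * \int[mu]_(x in E i) (h x)%:E))%E.
  rewrite -(@mulr_powRB1 _ (c i) p) ?(ltW (c0 _))// mulrC EFinM -muleA [X in (_ <= X)%E]muleCA.
  by rewrite lee_wpmul2l ?lee_fin ?powR_ge0//; exact: weak.
have S3 : (\sum_(i < N) ((c i `^ q)%:E * \int[mu]_(x in E i) (h x)%:E) <=
    K%:E * \int[mu]_x (h x * phi x `^ q)%:E)%E.
  under eq_bigr => i _.
    rewrite (ge0_integral_indicl h (mE i)) -ge0_integralZl_EFin ?powR_ge0//; last 2 first.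
    - by move=> x _; rewrite lee_fin mulr_ge0.
    - by apply/measurable_EFinP; exact: measurable_funM.
    over.
  rewrite -ge0_integral_sum//; last 2 first.
  - move=> i; apply: emeasurable_funM => //.
    by apply/measurable_EFinP; exact: measurable_funM.
  - by move=> i x _; rewrite mule_ge0// lee_fin ?powR_ge0// mulr_ge0.
  have mhp : measurable_fun setT (fun x => h x * phi x `^ q).
    by apply: measurable_funM => //; exact: mpow.
  rewrite -ge0_integralZl_EFin ?(ltW K0)//; last 2 first.
  - by move=> x _; rewrite lee_fin mulr_ge0// powR_ge0.
  - exact/measurable_EFinP.
  apply: ge0_le_integral => //.
  - move=> x _; apply: sume_ge0 => i _.
    by rewrite mule_ge0// lee_fin ?powR_ge0// mulr_ge0.
  - apply: emeasurable_sum => i; apply: emeasurable_funM => //.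
    by apply/measurable_EFinP; exact: measurable_funM.
  - by apply: emeasurable_funM => //; exact/measurable_EFinP.
  - move=> x _; under eq_bigr do rewrite -EFinM EE mulrCA.
    rewrite sumEFin -EFinM lee_fin -mulr_sumr mulrCA ler_wpM2l//.
    exact: dyadic_sum_le_powR.
have S4 : (\int[mu]_x (h x * phi x `^ q)%:E <=
    (B^-1)%:E * \int[mu]_x (phi x `^ p)%:E + (B `^ q)%:E * \int[mu]_x (h x `^ p)%:E)%E.
  rewrite -!ge0_integralZl_EFin ?powR_ge0 ?invr_ge0 ?(ltW B0)//; first last.
  - by apply/measurable_EFinP; exact: mpow.
  - by move=> x _; rewrite lee_fin powR_ge0.
  - by apply/measurable_EFinP; exact: mpow.
  - by move=> x _; rewrite lee_fin powR_ge0.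
  rewrite -ge0_integralD//; first last.
  - by apply: emeasurable_funM => //; apply/measurable_EFinP; exact: mpow.
  - by move=> x _; rewrite lee_fin mulr_ge0 ?powR_ge0.
  - by apply: emeasurable_funM => //; apply/measurable_EFinP; exact: mpow.
  - by move=> x _; rewrite lee_fin mulr_ge0 ?powR_ge0// invr_ge0 ltW.
  apply: ge0_le_integral => //.
  - by move=> x _; rewrite lee_fin mulr_ge0 ?powR_ge0.
  - by apply/measurable_EFinP/measurable_funM => //; exact: mpow.
  - by apply: emeasurable_funD; apply: emeasurable_funM => //; apply/measurable_EFinP; exact: mpow.
  - by move=> x _; rewrite -!EFinM -EFinD lee_fin; exact: young_weighted.
have S : (\int[mu]_x (phi x `^ p)%:E <= (B / 2)%:E *
    ((B^-1)%:E * \int[mu]_x (phi x `^ p)%:E + (B `^ q)%:E * \int[mu]_x (h x `^ p)%:E))%E.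
  apply: le_trans S1 _.
  have -> : B / 2 = 2 `^ p * A * K by rewrite /B; field.
  rewrite -mulrA EFinM -muleA lee_wpmul2l ?lee_fin ?powR_ge0//.
  apply: le_trans (_ : (A%:E * \sum_(i < N) ((c i `^ q)%:E * \int[mu]_(x in E i) (h x)%:E) <= _)%E).
    rewrite ge0_sume_distrr; first exact: lee_sum.
    move=> i _; rewrite mule_ge0 ?lee_fin ?powR_ge0// integral_ge0// => x _.
    by rewrite lee_fin.
  rewrite EFinM -muleA lee_wpmul2l ?lee_fin ?(ltW A0)//.
  by apply: le_trans S3 _; rewrite lee_wpmul2l ?lee_fin ?(ltW K0).
move: S; set X := (\int[mu]_x (phi x `^ p)%:E)%E in phifin *.
have X0 : (0 <= X)%E by apply: integral_ge0 => x _; rewrite lee_fin powR_ge0.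
set Y := (\int[mu]_x (h x `^ p)%:E)%E.
have Y0 : (0 <= Y)%E by apply: integral_ge0 => x _; rewrite lee_fin powR_ge0.
case: X phifin X0 => // x _ x0.
(* If the integral of [h^p] is infinite the right side is [+oo]. Otherwise both integrals are real
   numbers and [x / 2] may be subtracted from both sides. *)
case: Y Y0 => [y y0| _ _|//]; last first.
  by rewrite gt0_muley ?leey// lte_fin powR_gt0.
move=> xyE; rewrite -EFinM lee_fin.
have xy : x <= B / 2 * (B^-1 * x + B `^ q * y) by rewrite -lee_fin; exact: xyE.
have -> : B `^ p = B * B `^ q by rewrite mulr_powRB1// ltW.
have : B / 2 * (B^-1 * x + B `^ q * y) = 2^-1 * x + 2^-1 * (B * B `^ q * y) by field; lra.
by lra.
Qed.

End strong_type.

(** * The maximal function over rational cubes *)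

Section vitali.
Context {R : realType} (n : nat).
Local Notation L := (@lebesgue_rV R n).

Lemma measurable_cubes (I : choiceType) (x : I -> 'rV[R]_n) (r : I -> R) (s : seq I) :
  measurable (\bigcup_(i in [set` s]) cube (x i) (r i)).
Proof. by rewrite bigcup_seq; apply: bigsetU_measurable => i _; exact: measurable_cube. Qed.

Lemma lebesgue_cube_triple (c : 'rV[R]_n) r : 0 <= r ->
  (L (cube c (3 * r)) = (3 ^+ n)%:E * L (cube c r))%E.
Proof.
by move=> r0; rewrite !lebesgue_cube ?mulr_ge0// -EFinM -exprMn mulrnAr.
Qed.

(* Greedy selection: keep the largest cube, drop the cubes meeting it (they lie in
   its triple), and recurse on U minus that cube. *)
Lemma vitali_cubes_sorted (I : choiceType) (x : I -> 'rV[R]_n) (r : I -> R)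
    (h : 'rV[R]_n -> R) (c : R) (s : seq I) (U : set 'rV[R]_n) :
  measurable_fun setT h -> (forall y, 0 <= h y) -> 0 <= c ->
  (forall i, 0 <= r i) -> sorted (fun i j => r j <= r i) s -> measurable U ->
  (forall i, i \in s -> cube (x i) (r i) `<=` U /\
    (c%:E * L (cube (x i) (r i)) <= \int[L]_(y in cube (x i) (r i)) (h y)%:E)%E) ->
  (c%:E * L (\bigcup_(i in [set` s]) cube (x i) (r i)) <=
   (3 ^+ n)%:E * \int[L]_(y in U) (h y)%:E)%E.
Proof.
move=> mh h0 c0 r0.
have [k ks] := ubnP (size s); elim: k s U ks => // k IH [|i0 s] U ks ss mU sU.
  rewrite (_ : \bigcup_(i in _) _ = set0) ?measure0 ?mule0; last first.
    by apply/seteqP; split=> // v [].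
  by rewrite mule_ge0// integral_ge0// => y _; rewrite lee_fin.
pose Q i := cube (x i) (r i).
have trr : transitive (fun i j => r j <= r i).
  by move=> i j l ij jl; exact: le_trans jl ij.
pose s' := [seq i <- s | `[< Q i `&` Q i0 = set0 >]].
have rmax i : i \in s -> r i <= r i0.
  by move: i; apply/allP; exact: (order_path_min trr ss).
have mQ i : measurable (Q i) by exact: measurable_cube.
have mcov : measurable (\bigcup_(i in [set` s']) Q i) by exact: measurable_cubes.
have cov : \bigcup_(i in [set` i0 :: s]) Q i `<=`
    cube (x i0) (3 * r i0) `|` \bigcup_(i in [set` s']) Q i.
  move=> v [i /= + Qv]; rewrite inE => /predU1P[i_i0|si].
    rewrite i_i0 in Qv.
    by left; move=> j; apply: lt_le_trans (Qv j) _; have := r0 i0; lra.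
  have [Qi|] := pselect (Q i `&` Q i0 = set0).
    by right; exists i => //=; rewrite mem_filter si andbT; exact/asboolP.
  move=> /eqP/set0P[w [wi w0]]; left; move=> j.
  have := Qv j; have := wi j; have := w0 j; have := rmax _ si.
  rewrite !ltr_norml => ri /andP[? ?] /andP[? ?] /andP[? ?].
  by apply/andP; split; lra.
have [Q0U avg0] := sU i0 (mem_head _ _).
have IHs' : (c%:E * L (\bigcup_(i in [set` s']) Q i) <=
    (3 ^+ n)%:E * \int[L]_(y in U `\` Q i0) (h y)%:E)%E.
  apply: IH.
  - by rewrite size_filter; apply: leq_ltn_trans (count_size _ _) _.
  - by apply: sorted_filter => //; exact: path_sorted ss.
  - exact: measurableD.
  - move=> i; rewrite mem_filter => /andP[/asboolP Qi0 si].
    have [|QiU ?] := sU i; first by rewrite inE si orbT.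
    split=> // v Qv; split; first exact: QiU.
    by move=> Q0v; suff : (Q i `&` Q i0) v by rewrite Qi0.
have U_E : (\int[L]_(y in U) (h y)%:E = \int[L]_(y in Q i0) (h y)%:E +
    \int[L]_(y in U `\` Q i0) (h y)%:E)%E.
  rewrite -[in LHS](setDUK Q0U) ge0_integral_setU//.
  - exact: measurable_cube.
  - by apply: measurableD => //; exact: measurable_cube.
  - by apply: measurable_funTS; exact/measurable_EFinP.
  - by move=> y _; rewrite lee_fin.
  - by apply/disj_setPS => y [? []].
rewrite U_E ge0_muleDr; last 2 first.
- by apply: integral_ge0 => y _; rewrite lee_fin.
- by apply: integral_ge0 => y _; rewrite lee_fin.
apply: le_trans (_ : (c%:E * (L (cube (x i0) (3 * r i0)) +
    L (\bigcup_(i in [set` s']) Q i)) <= _)%E).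
  rewrite lee_wpmul2l ?lee_fin//.
  apply: le_trans (measureU2 _ _ mcov); last exact: measurable_cube.
  apply: le_measure => //; rewrite inE; first exact: measurable_cubes.
  by apply: measurableU => //; exact: measurable_cube.
rewrite ge0_muleDr//; apply: leeD IHs'.
by rewrite lebesgue_cube_triple// muleCA lee_wpmul2l ?lee_fin ?exprn_ge0.
Qed.

Lemma vitali_cubes (I : choiceType) (x : I -> 'rV[R]_n) (r : I -> R)
    (h : 'rV[R]_n -> R) (c : R) (s : seq I) (U : set 'rV[R]_n) :
  measurable_fun setT h -> (forall y, 0 <= h y) -> 0 <= c ->
  (forall i, 0 <= r i) -> measurable U ->
  (forall i, i \in s -> cube (x i) (r i) `<=` U /\
    (c%:E * L (cube (x i) (r i)) <= \int[L]_(y in cube (x i) (r i)) (h y)%:E)%E) ->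
  (c%:E * L (\bigcup_(i in [set` s]) cube (x i) (r i)) <=
   (3 ^+ n)%:E * \int[L]_(y in U) (h y)%:E)%E.
Proof.
move=> mh h0 c0 r0 mU sU; pose s' := sort (fun i j => r j <= r i) s.
have -> : [set` s] = [set` s'] by apply/seteqP; split=> i /=; rewrite mem_sort.
apply: vitali_cubes_sorted => //; first by apply: sort_sorted => i j; exact: le_total.
by move=> i; rewrite mem_sort; exact: sU.
Qed.

End vitali.

(** * Maxima over finitely many rational cubes and their monotone limit *)

Section rat_maximal.
Context {R : realType} (n : nat).
Local Notation L := (@lebesgue_rV R n).
Variable h : 'rV[R]_n -> R.

(** A cube of measure zero gets average zero, division by zero being zero, and so never contributes
    to a level set at a positive height. *)
Definition rat_avg (k : nat) : R :=
  fine (\int[L]_(y in @rat_cube R n k) (h y)%:E) / fine (L (@rat_cube R n k)).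

Fixpoint rat_maximal (N : nat) (y : 'rV[R]_n) : R :=
  if N is k.+1 then Num.max (rat_maximal k y) (rat_avg k * \1_(@rat_cube R n k) y)
  else 0.

Hypothesis mh : measurable_fun setT h.
Hypothesis h0 : forall y, 0 <= h y.
Variable M : R.
Hypothesis hM : forall y, h y <= M.

Lemma rat_ball_ge0 k : 0 <= (rat_ball n k).2 :> R.
Proof. exact: normr_ge0. Qed.

Lemma lebesgue_rat_cube_fin k : L (@rat_cube R n k) \is a fin_num.
Proof. by rewrite /rat_cube lebesgue_cube// rat_ball_ge0. Qed.

(** Boundedness of [h] ensures that [fine] loses nothing in [rat_avg]. *)
Lemma integral_cube_fin (c : 'rV[R]_n) r : 0 <= r ->
  (\int[L]_(y in cube c r) (h y)%:E)%E \is a fin_num.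
Proof.
move=> r0; rewrite ge0_fin_numE; last by apply: integral_ge0 => y _; rewrite lee_fin.
apply: le_lt_trans (_ : (\int[L]_(y in cube c r) (cst M%:E y) < +oo)%E).
  apply: ge0_le_integral => //.
  - exact: measurable_cube.
  - by move=> y _; rewrite lee_fin.
  - by apply: measurable_funTS; exact/measurable_EFinP.
  - by move=> y _; rewrite lee_fin.
rewrite integral_cst; last exact: measurable_cube.
by rewrite [X in (_ * X)%E](lebesgue_cube c r0) -EFinM ltry.
Qed.

Lemma rat_avg_ge0 k : 0 <= rat_avg k.
Proof.
by rewrite divr_ge0// fine_ge0// integral_ge0// => y _; rewrite lee_fin.
Qed.

Lemma rat_avgE k : 0 < fine (L (@rat_cube R n k)) ->
  ((rat_avg k)%:E * L (@rat_cube R n k) = \int[L]_(y in @rat_cube R n k) (h y)%:E)%E.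
Proof.
move=> L0; rewrite -(fineK (lebesgue_rat_cube_fin k)) -EFinM divfK ?gt_eqF//.
by rewrite fineK// integral_cube_fin// rat_ball_ge0.
Qed.

Lemma rat_maximalS N y : rat_maximal N.+1 y =
  Num.max (rat_maximal N y) (rat_avg N * \1_(@rat_cube R n N) y).
Proof. by []. Qed.

Lemma rat_maximal_ge0 N y : 0 <= rat_maximal N y.
Proof.
elim: N => [|N IH]; first by [].
by rewrite rat_maximalS le_max IH.
Qed.

Lemma rat_maximal_homo y : {homo rat_maximal^~ y : i j / (i <= j)%N >-> i <= j}.
Proof.
apply: homo_leq => [//|i j k|N]; first exact: le_trans.
by rewrite rat_maximalS le_max lexx.
Qed.

Lemma measurable_rat_maximal N : measurable_fun setT (rat_maximal N).
Proof.
elim: N => [|N IH].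
  exact: measurable_cst.
rewrite (_ : rat_maximal N.+1 = rat_maximal N \max
    (fun y => rat_avg N * \1_(@rat_cube R n N) y)); last first.
  by apply/funext => y; rewrite rat_maximalS.
apply: measurable_maxr => //; apply: measurable_funM => //.
by apply: measurable_indic; exact: measurable_rat_cube.
Qed.

(** The level set takes the form that the covering lemma accepts: a finite union of cubes on each of
    which the average exceeds [c]. Positivity of [c] rules out the initial value 0 and the value 0
    of the indicators. *)
Lemma rat_maximal_level N c : 0 < c -> [set y | c < rat_maximal N y] =
  \bigcup_(k in [set` [seq k <- iota 0 N | c < rat_avg k]]) @rat_cube R n k.
Proof.
move=> c0.
transitivity (\bigcup_(k in [set k | (k < N)%N /\ c < rat_avg k]) @rat_cube R n k).
  apply/seteqP; split=> y.
    elim: N => [|N IH]; first by rewrite /= ltNge (ltW c0).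
    rewrite [X in X -> _]/= lt_max => /orP[/IH[k [kN ck] ky]|].
      by exists k => //; split=> //; exact: ltnW.
    rewrite indicE; case: (boolP (y \in @rat_cube R n N)) => yN; last first.
      by rewrite mulr0 ltNge (ltW c0).
    by rewrite mulr1 => cN; exists N => //; rewrite inE in yN.
  move=> [k [kN ck] ky].
  apply: lt_le_trans ck _; apply: le_trans (rat_maximal_homo y kN).
  by rewrite rat_maximalS le_max indicE mem_set// mulr1 lexx orbT.
by congr (bigcup _ _); apply/seteqP; split=> k; rewrite /= mem_filter mem_iota add0n andbC => /andP.
Qed.

(** The covering lemma is applied with [U] equal to the level set itself. This keeps the integral of
    [h] restricted to that set, as the passage to strong type requires. *)
Lemma rat_maximal_weak N c : 0 < c ->
  (c%:E * L [set y | (c < rat_maximal N y)%R] <=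
   (3 ^+ n)%:E * \int[L]_(y in [set y | (c < rat_maximal N y)%R]) (h y)%:E)%E.
Proof.
move=> c0; rewrite rat_maximal_level//.
apply: vitali_cubes => //.
- exact: ltW.
- exact: rat_ball_ge0.
- exact: measurable_cubes.
- move=> k /[dup] ks; rewrite mem_filter => /andP[ck _]; split.
    by move=> v kv; exists k.
  have [L0|L0] := ltP 0 (fine (L (@rat_cube R n k))).
    by rewrite -[leRHS]rat_avgE// lee_wpmul2r// lee_fin ltW.
  move: ck; rewrite /rat_avg (_ : fine (L _) = 0); last first.
    by apply/eqP; rewrite eq_le L0 fine_ge0.
  by rewrite invr0 mulr0 ltNge (ltW c0).
Qed.

(** Only finitely many values occur, so the positive ones stay away from zero; finitely many dyadic
    levels then suffice to slice the function. *)
Lemma rat_maximal_range N : exists d D, [/\ 0 < d, 0 <= D &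
  forall y, rat_maximal N y = 0 \/ d < rat_maximal N y <= D].
Proof.
elim: N => [|N [d [D [d0 D0 IH]]]].
  by exists 1, 0; split=> // y; left.
have [avg0|avg0] := ltP 0 (rat_avg N).
  (* Halving the average makes the lower bound strict at the new value. *)
  exists (Num.min d (rat_avg N / 2)), (Num.max D (rat_avg N)).
  split; [by rewrite lt_min d0 divr_gt0|by rewrite le_max D0|move=> y].
  rewrite rat_maximalS indicE.
  have [IHy|/andP[dy yD]] := IH y; case: (_ \in _); rewrite ?mulr1 ?mulr0.
  - rewrite IHy (max_idPr (ltW avg0)); right; rewrite gt_min le_max lexx orbT andbT.
    by apply/orP; right; lra.
  - by left; rewrite IHy maxxx.
  - by right; rewrite lt_max !gt_min dy/= ge_max !le_max yD lexx orbT.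
  - by right; rewrite (max_idPl (rat_maximal_ge0 _ _)) gt_min dy/= le_max yD.
exists d, D; split=> // y; rewrite rat_maximalS (max_idPl _)//.
by apply: le_trans (rat_maximal_ge0 N y); apply: mulr_le0_ge0.
Qed.

Lemma rat_maximal_dyadic N : exists d k, 0 < d /\
  forall y, rat_maximal N y = 0 \/ d < rat_maximal N y <= d * 2 ^+ k.
Proof.
have [d [D [d0 D0 yD]]] := rat_maximal_range N.
(* The exponent [m = trunc (D / d) + 1] works because [D / d < m <= 2 ^ m]. *)
exists d, (Num.truncn (D / d)).+1; split=> // y; have [->|/andP[dy yD']] := yD y; [by left|right].
rewrite dy (le_trans yD')//= -ler_pdivrMl// mulrC.
apply/ltW/(lt_le_trans (truncnS_gt _)).
by rewrite -natrX ler_nat ltnW// ltn_expl.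
Qed.

(** The power of a maximum is at most the sum of the powers, so each further cube adds a finite
    amount. This finiteness is what permits the absorption in the strong type estimate. *)
Lemma integral_rat_maximal_fin N p : 0 < p ->
  (\int[L]_y (rat_maximal N y `^ p)%:E < +oo)%E.
Proof.
move=> p0.
have mpow k : measurable_fun setT (fun y => rat_maximal k y `^ p).
  by apply: measurableT_comp (measurable_powR _) _; exact: measurable_rat_maximal.
elim: N => [|N IH].
  rewrite integral0_eq ?ltry// => y _.
  by rewrite /= powR0// gt_eqF.
have mQ : measurable (@rat_cube R n N) by exact: measurable_rat_cube.
apply: le_lt_trans (_ : (\int[L]_y ((rat_maximal N y `^ p)%:E +
    (rat_avg N `^ p)%:E * (\1_(@rat_cube R n N) y)%:E) < +oo)%E).
  apply: ge0_le_integral => //.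
  - by move=> y _; rewrite lee_fin powR_ge0.
  - exact/measurable_EFinP.
  - apply: emeasurable_funD; first exact/measurable_EFinP.
    by apply: emeasurable_funM => //; apply/measurable_EFinP; exact: measurable_indic.
  - move=> y _; rewrite -EFinM -EFinD lee_fin rat_maximalS indicE.
    case: (_ \in _); rewrite ?mulr1 ?mulr0 ?addr0.
      by rewrite maxEle; case: ifP => _; rewrite ?lerDr ?lerDl powR_ge0.
    by rewrite (max_idPl (rat_maximal_ge0 _ _)).
rewrite ge0_integralD//; first last.
- by apply: emeasurable_funM => //; apply/measurable_EFinP; exact: measurable_indic.
- by move=> y _; rewrite mule_ge0// lee_fin powR_ge0.
- exact/measurable_EFinP.
- by move=> y _; rewrite lee_fin powR_ge0.
rewrite ge0_integralZl_EFin ?powR_ge0//; last first.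
  by apply/measurable_EFinP; exact: measurable_indic.
rewrite integral_indic// setIT lte_add_pinfty//.
apply: lte_mul_pinfty; rewrite ?lee_fin ?powR_ge0//.
by have := lebesgue_rat_cube_fin N; rewrite ge0_fin_numE//.
Qed.

(** The gap [d] and the number of levels depend on [N], but the constant does not, so the bound
    survives the passage to the limit in [N]. *)
Lemma rat_maximal_strong N p : 1 < p ->
  (\int[L]_y (rat_maximal N y `^ p)%:E <=
   (maximal_const p (3 ^+ n) `^ p)%:E * \int[L]_y (h y `^ p)%:E)%E.
Proof.
move=> p1; have [d [k [d0 yk]]] := rat_maximal_dyadic N.
apply: (strong_type_of_weak_type (d := d) (N := k)) => //.
- exact: measurable_rat_maximal.
- exact: rat_maximal_ge0.
- by move=> c; exact: rat_maximal_weak.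
- by apply: integral_rat_maximal_fin; lra.
Qed.

(** The [p]-th power of the uncentred maximal function over rational cubes. Powers are taken before
    the supremum, so that every approximant is real-valued. *)
Definition maximal_pow p (y : 'rV[R]_n) : \bar R :=
  ereal_sup (range (fun N => (rat_maximal N y `^ p)%:E)).

Lemma le_maximal_pow p N y : ((rat_maximal N y `^ p)%:E <= maximal_pow p y)%E.
Proof. by apply: ereal_sup_ubound; exists N. Qed.

Lemma maximal_pow_limn p y : 0 < p ->
  maximal_pow p y = limn (fun N => (rat_maximal N y `^ p)%:E).
Proof.
move=> p0; apply/esym/cvg_lim => //; apply: ereal_nondecreasing_cvgn => i j ij.
rewrite lee_fin; apply: ge0_ler_powR; rewrite ?nnegrE ?rat_maximal_ge0 ?(ltW p0)//.
exact: rat_maximal_homo.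
Qed.



Lemma integral_maximal_pow p : 1 < p ->
  (\int[L]_y maximal_pow p y <=
   (maximal_const p (3 ^+ n) `^ p)%:E * \int[L]_y (h y `^ p)%:E)%E.
Proof.
move=> p1; have p0 : 0 < p by lra.
under eq_integral do rewrite maximal_pow_limn//.
have mpow k : measurable_fun setT (fun y => (rat_maximal k y `^ p)%:E).
  apply/measurable_EFinP; apply: measurableT_comp (measurable_powR _) _.
  exact: measurable_rat_maximal.
have ge0pow k y : setT y -> (0 <= (rat_maximal k y `^ p)%:E)%E.
  by rewrite lee_fin powR_ge0.
have homopow y : setT y -> {homo (fun k => (rat_maximal k y `^ p)%:E) :
    i j / (i <= j)%N >-> (i <= j)%E}.
  move=> _ i j ij; rewrite lee_fin.
  apply: ge0_ler_powR; rewrite ?nnegrE ?rat_maximal_ge0 ?(ltW p0)//.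
  exact: rat_maximal_homo.
rewrite (monotone_convergence L measurableT mpow ge0pow homopow).
apply: lime_le; last by near=> N; exact: rat_maximal_strong.
apply: ereal_nondecreasing_is_cvgn => i j ij.
apply: ge0_le_integral; [exact: measurableT|exact: ge0pow|exact: mpow|exact: mpow|].
move=> y _; have H := homopow y I i j ij.
exact: H.
Unshelve. all: by end_near. Qed.

Lemma integral_cube_le_maximal (y : 'rV[R]_n) t : 0 < t ->
  exists N, (\int[L]_(v in cube y t) (h v)%:E <= ((6 * t) ^+ n * rat_maximal N y)%:E)%E.
Proof.
move=> t0; have [k [/andP[r1 r2] yk]] := rat_cube_approx y t0.
(* [rat_maximal N] involves the cubes of index below [N]; cube [k] first enters at [k.+1]. *)
exists k.+1.
have r0 : 0 < (rat_ball n k).2 :> R by lra.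
have sub : cube y t `<=` @rat_cube R n k.
  move=> v vy i; have := yk i; have := vy i.
  rewrite !ltr_norml => /andP[? ?] /andP[? ?]; apply/andP; split; lra.
apply: le_trans (_ : (\int[L]_(v in @rat_cube R n k) (h v)%:E <= _)%E).
  apply: ge0_subset_integral => //; first exact: measurable_cube.
  - exact: measurable_cube.
  - by apply: measurable_funTS; exact/measurable_EFinP.
  - by move=> v _; rewrite lee_fin.
have LE : L (@rat_cube R n k) = (((rat_ball n k).2 *+ 2) ^+ n)%:E by rewrite lebesgue_cube// ltW.
rewrite -rat_avgE; last by rewrite LE/= exprn_gt0// pmulrn_lgt0.
rewrite LE -EFinM lee_fin mulrC; apply: ler_pM.
- by rewrite exprn_ge0// mulrn_wge0// ltW.
- exact: rat_avg_ge0.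
- move: r0 r1 r2; move: (rat_ball n k).2 => r r0 r1 r2.
  by apply: lerXn2r; rewrite ?nnegrE ?mulr2n; lra.
- rewrite rat_maximalS le_max indicE mem_set ?mulr1 ?lexx ?orbT// => i.
  by apply: lt_trans (yk i) _; lra.
Qed.

End rat_maximal.

Lemma ge0_integral_mrestr d (T : measurableType d) (R : realType)
    (mu : {measure set T -> \bar R}) (D : set T) (mD : measurable D) (f : T -> \bar R) :
  measurable_fun setT f -> (forall x, 0 <= f x)%E ->
  (\int[mrestr mu mD]_x f x = \int[mu]_(x in D) f x)%E.
Proof.
move=> mf f0.
rewrite (@ge0_negligible_integral _ _ _ _ setT (~` D))//; last 2 first.
- exact: measurableC.
- by change (mu (~` D `&` D) = 0%E); rewrite setICl measure0.
rewrite setTD setCK; apply: eq_measure_integral => A mA AD.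
by change (mu (A `&` D) = mu A); rewrite setIidl.
Qed.

(** * Volumes of Euclidean balls and annuli *)

Section euclidean_ball.
Context {R : realType} (n : nat).
Local Notation L := (@lebesgue_rV R n).

Lemma sqnormZ (c : R) (v : 'rV[R]_n) : sqnorm_rV (c *: v) = c ^+ 2 * sqnorm_rV v.
Proof. by rewrite /sqnorm_rV mulr_sumr; apply: eq_bigr => i _; rewrite mxE exprMn. Qed.

Lemma sqnorm_ge0 (v : 'rV[R]_n) : 0 <= sqnorm_rV v.
Proof. by apply: sumr_ge0 => i _; exact: sqr_ge0. Qed.

Lemma sqr_coord_le_sqnorm (v : 'rV[R]_n) i : v ord0 i ^+ 2 <= sqnorm_rV v.
Proof.
by rewrite /sqnorm_rV (bigD1 i)//= lerDl sumr_ge0// => j _; exact: sqr_ge0.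
Qed.

Lemma measurable_sqnorm : measurable_fun setT (@sqnorm_rV R n).
Proof.
by apply: measurable_sum => i; apply: measurable_funX; exact: measurable_coord_rV.
Qed.

(** The ball of radius [sqrt a]. With squared radii, the fibres of a shell are described by
    subtraction alone. *)
Definition sqball (a : R) : set 'rV[R]_n := [set v | sqnorm_rV v <= a].

Lemma measurable_sqball a : measurable (sqball a).
Proof.
rewrite (_ : sqball a = @sqnorm_rV R n @^-1` `]-oo, a]); last first.
  by apply/seteqP; split=> v; rewrite /= in_itv.
by rewrite -[X in measurable X]setTI; exact: measurable_sqnorm.
Qed.

(** The half-side 2 leaves room, because cubes are open and the unit ball is closed. *)
Lemma sqball1_sub_cube : sqball 1 `<=` cube 0 2.
Proof.
move=> v v1 i; rewrite mxE subr0.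
have := le_trans (sqr_coord_le_sqnorm v i) v1.
by rewrite -real_normK ?num_real// -[X in _ <= X](expr1n _ 2) ler_pXn2r ?nnegrE//; lra.
Qed.

Definition ball_volume : R := fine (L (sqball 1)).

Lemma ball_volumeE : L (sqball 1) = ball_volume%:E.
Proof.
rewrite /ball_volume fineK// ge0_fin_numE//.
apply: le_lt_trans (_ : L (cube 0 2) < +oo)%E.
  apply: le_measure; rewrite ?inE; [exact: measurable_sqball|exact: measurable_cube|].
  exact: sqball1_sub_cube.
by rewrite lebesgue_cube// ltry.
Qed.

Lemma ball_volume_ge0 : 0 <= ball_volume.
Proof. exact: fine_ge0. Qed.

Lemma lebesgue_sqball a : 0 < a -> L (sqball a) = (Num.sqrt a ^+ n * ball_volume)%:E.
Proof.
move=> a0.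
have s0 : 0 < Num.sqrt a by rewrite sqrtr_gt0.
rewrite -(lebesgue_affine_rV 0 (lt0r_neq0 s0) (measurable_sqball a)).
rewrite (ger0_norm (sqrtr_ge0 a)) EFinM -ball_volumeE; congr (_ * L _)%E.
apply/seteqP; split=> v; rewrite /sqball /= add0r sqnormZ sqr_sqrtr ?(ltW a0)//.
  by rewrite ger_pMr.
by rewrite ger_pMr.
Qed.

(** For [a > 0] put [s = sqrt b] and [t = sqrt a]. Then [s^n - t^n] is [s - t] times [n] terms, each
    at most [s^(n-1) <= s <= s + t] since [n >= 2] and [s <= 1], and [(s - t) (s + t) = b - a]. For
    [a <= 0] the annulus lies in the ball of squared radius [b - a <= 1], where [c^(n/2) <= c]
    applies. *)
Lemma lebesgue_sqannulus (a b : R) : (2 <= n)%N -> a < b -> b <= 1 -> b - a <= 1 ->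
  (L [set v | (a < sqnorm_rV v <= b)%R] <= ((b - a) * n%:R * ball_volume)%:E)%E.
Proof.
move=> n2 ab b1 ba1.
have n1 : 1 <= n%:R :> R by rewrite ler1n ltnW.
have annE : [set v : 'rV[R]_n | a < sqnorm_rV v <= b] = sqball b `\` sqball a.
  apply/seteqP; split=> v /=; rewrite /sqball/=.
    by move=> /andP[av ->]; split=> //; apply/negP; rewrite -ltNge.
  by move=> [-> /negP]; rewrite -ltNge => ->.
have mA : measurable [set v : 'rV[R]_n | a < sqnorm_rV v <= b].
  by rewrite annE; apply: measurableD; exact: measurable_sqball.
have sqrt_pow c : 0 <= c -> c <= 1 -> Num.sqrt c ^+ n <= c.
  move=> c0 c1; rewrite -[X in _ <= X]sqr_sqrtr//.
  by apply: ler_wiXn2l; rewrite ?sqrtr_ge0// -sqrtr1 ler_wsqrtr.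
have [a0|a0] := leP a 0.
  apply: le_trans (_ : L (sqball (b - a)) <= _)%E.
    apply: le_measure; rewrite ?inE//; first exact: measurable_sqball.
    by move=> v /= /andP[_ vb]; rewrite /sqball/=; lra.
  rewrite lebesgue_sqball ?subr_gt0// lee_fin ler_wpM2r ?ball_volume_ge0//.
  apply: (@le_trans _ _ (b - a)); first by apply: sqrt_pow; lra.
  by rewrite ler_peMr//; lra.
have b0 : 0 < b by lra.
rewrite annE measureD; [|exact: measurable_sqball|exact: measurable_sqball|]; last first.
  by rewrite [ltLHS](lebesgue_sqball b0) ltry.
rewrite setIidr; last by move=> v; rewrite /sqball/=; lra.
rewrite [X in (X - _)%E](lebesgue_sqball b0) [X in (_ - X)%E](lebesgue_sqball a0).
rewrite -EFinB lee_fin -mulrBl ler_wpM2r ?ball_volume_ge0//.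
set s := Num.sqrt b; set t := Num.sqrt a.
have t0 : 0 <= t by exact: sqrtr_ge0.
have ts : t <= s by apply: ler_wsqrtr; lra.
have s1 : s <= 1 by rewrite -sqrtr1 ler_wsqrtr.
have -> : b - a = (s - t) * (s + t).
  by rewrite -subr_sqr !sqr_sqrtr//; lra.
rewrite subrXX -mulrA ler_wpM2l ?subr_ge0//.
apply: le_trans (_ : \sum_(i < n) s <= _).
  apply: ler_sum => i _.
  apply: le_trans (_ : s ^+ (n.-1 - i) * s ^+ i <= _).
    by rewrite ler_wpM2l ?exprn_ge0 ?(le_trans t0)// lerXn2r ?nnegrE// (le_trans t0).
  rewrite -exprD subnK; last by rewrite -ltnS prednK// ltnW.
  rewrite -[X in _ <= X]expr1; apply: ler_wiXn2l => //; first by rewrite (le_trans t0).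
  by rewrite -subn1 subn_gt0.
by rewrite sumr_const card_ord -[s *+ n]mulr_natr ler_wpM2r// lerDl.
Qed.

End euclidean_ball.

(** * The marginals of surface measure *)

Section shell.
Context {R : realType} (n : nat).
Local Notation L := (@lebesgue_rV R n).
Local Notation T := ('rV[R]_n * 'rV[R]_n)%type.
Local Notation L2 := (L \x L)%E.

Definition shell (s : R) : set T := [set u | s < pair_sqnorm u <= 1].

Lemma pair_sqnorm_ge0 (u : T) : 0 <= pair_sqnorm u.
Proof. by rewrite addr_ge0 ?sqnorm_ge0. Qed.

Lemma measurable_pair_sqnorm_itv (i : interval R) :
  measurable [set u : T | pair_sqnorm u \in i].
Proof.
rewrite (_ : mkset _ = @pair_sqnorm R n @^-1` [set` i])//.
by rewrite -[X in measurable X]setTI; exact: measurable_pair_sqnorm.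
Qed.

Lemma measurable_sphere : measurable (sphere n : set T).
Proof.
rewrite (_ : sphere n = [set u : T | pair_sqnorm u \in `[1, 1]]).
  exact: measurable_pair_sqnorm_itv.
by apply/seteqP; split=> u; rewrite /sphere /= in_itv/= -eq_le eq_sym => /eqP.
Qed.

Lemma measurable_shell s : measurable (shell s).
Proof.
rewrite (_ : shell s = [set u | pair_sqnorm u \in `]s, 1]]).
  exact: measurable_pair_sqnorm_itv.
by apply/seteqP; split=> u; rewrite /shell /= in_itv.
Qed.

Lemma measurable_fun_indic_shell s :
  measurable_fun setT (fun u : T => \1_(shell s) u : R).
Proof. by apply: measurable_indic; exact: measurable_shell. Qed.

Lemma measurable_dilation (t : R) :
  measurable_fun setT (fun u : T => (t *: u.1, t *: u.2) : T).
Proof.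
apply: measurable_fun_pair; apply: measurable_fun_rV => i;
  under eq_fun do rewrite mxE; apply: measurable_funM => //.
  exact: measurableT_comp (measurable_coord_rV i) measurable_fst.
exact: measurableT_comp (measurable_coord_rV i) measurable_snd.
Qed.

Lemma lebesgue_dilation (t : R) (A : set T) : 0 < t -> measurable A ->
  (((t ^+ n) ^+ 2)%:E * L2 ((fun u => (t *: u.1, t *: u.2)%R) @^-1` A) = L2 A)%E.
Proof.
move=> t0 mA; apply/esym.
have tn0 : 0 <= (t ^+ n) ^+ 2 by rewrite exprn_ge0// exprn_ge0// ltW.
pose m : {measure set T -> \bar R} := mscale (NngNum tn0)
  (measure_function_pushforward__canonical__measure_function_Measure
    L2 (@measurable_dilation t)).
rewrite -[RHS]/(m A).
apply: product_measure_unique => // B C mB mC.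
rewrite /m /= /mscale /= /pushforward.
have E : (fun u : T => (t *: u.1, t *: u.2)) @^-1` (B `*` C) =
    ((fun y => 0 + t *: y) @^-1` B) `*` ((fun y => 0 + t *: y) @^-1` C).
  by apply/seteqP; split=> u /=; rewrite !add0r.
apply: etrans (congr1 (fun S => (_ * L2 S)%E) E) _.
have mpre D : measurable D -> measurable ((fun y : 'rV[R]_n => 0 + t *: y) @^-1` D).
  by move=> mD; rewrite -[X in measurable X]setTI; exact: (measurable_affine_rV 0 t).
apply: etrans (congr1 (fun x => (_ * x)%E) (product_measure1E _ _ _ _)) _.
- exact: mpre.
- exact: mpre.
have := lebesgue_affine_rV 0 (lt0r_neq0 t0) mB.
have := lebesgue_affine_rV 0 (lt0r_neq0 t0) mC.
rewrite (gtr0_norm t0) => <- <-.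
by rewrite expr2 EFinM muleACA.
Qed.

Lemma pair_sqnorm_dilation (t : R) (u : T) :
  pair_sqnorm (t *: u.1, t *: u.2) = t ^+ 2 * pair_sqnorm u.
Proof. by rewrite /pair_sqnorm/= !sqnormZ mulrDr. Qed.

Lemma sphere_proj_dilation (t : R) (u : T) : 0 < t ->
  sphere_proj (t *: u.1, t *: u.2) = sphere_proj u.
Proof.
move=> t0; rewrite /sphere_proj pair_sqnorm_dilation/=.
rewrite sqrtrM ?sqr_ge0// sqrtr_sqr gtr0_norm// !scalerA.
by rewrite invfM mulrAC mulVf ?mul1r// gt_eqF.
Qed.

Lemma lebesgue2_punctured_ball_fin (A : set T) : measurable A ->
  A `<=` punctured_ball (n := n) -> (L2 A < +oo)%E.
Proof.
move=> mA Aball.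
apply: le_lt_trans (_ : L2 (cube 0 2 `*` cube 0 2) < +oo)%E.
  apply: le_measure; rewrite ?inE//.
    by apply: measurableX; exact: measurable_cube.
  move=> u /Aball /andP[_ u1]; rewrite /pair_sqnorm in u1.
  have := sqnorm_ge0 u.1; have := sqnorm_ge0 u.2 => ? ?.
  by split; apply: sqball1_sub_cube; rewrite /sqball/=; lra.
rewrite product_measure1E; [|exact: measurable_cube|exact: measurable_cube].
have cf : (L (cube 0 2) < +oo)%E by rewrite lebesgue_cube// ltry.
by apply: lte_mul_pinfty => //; rewrite ge0_fin_numE.
Qed.

(** The preimage of [A] under [sphere_proj] is a cone. Dilation by [sqrt s] carries its part in the
    punctured ball onto its part with [0 < |u|^2 <= s] and multiplies volume by
    [(sqrt s)^(2n) = s^n]; the shell is what remains. *)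
Lemma shell_cone (s : R) (A : set T) : 0 < s < 1 -> measurable A ->
  (L2 (@sphere_proj R n @^-1` A `&` shell s) =
   (1 - s ^+ n)%:E * L2 (@sphere_proj R n @^-1` A `&` punctured_ball (n := n)))%E.
Proof.
move=> /andP[s0 s1] mA.
pose P := @sphere_proj R n @^-1` A.
have mP : measurable P.
  by rewrite -[P]setTI; exact: (@measurable_sphere_proj R n).
pose small := [set u : T | pair_sqnorm u \in `]0, s]].
have mS : measurable small by exact: measurable_pair_sqnorm_itv.
have t0 : 0 < Num.sqrt s by rewrite sqrtr_gt0.
have dil := lebesgue_dilation t0 (measurableI _ _ mP mS).
have preE : (fun u : T => (Num.sqrt s *: u.1, Num.sqrt s *: u.2)) @^-1` (P `&` small) =
    P `&` punctured_ball (n := n).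
  apply/seteqP; split=> u; rewrite /P /small /punctured_ball /= sphere_proj_dilation//;
    by rewrite pair_sqnorm_dilation sqr_sqrtr ?(ltW s0)// in_itv/= pmulr_rgt0// ger_pMr.
rewrite preE -exprM mulnC exprM sqr_sqrtr ?(ltW s0)// in dil.
have ballE : P `&` punctured_ball (n := n) = (P `&` small) `|` (P `&` shell s).
  rewrite -setIUr; congr (_ `&` _); apply/seteqP; split=> u; rewrite /small /shell /= in_itv/=.
    by move=> /andP[u0 u1]; have [us|us] := leP (pair_sqnorm u) s; [left; rewrite u0|right].
  by case=> /andP[u0 u1]; apply/andP; split=> //; lra.
have mPb : measurable (P `&` punctured_ball (n := n)).
  by apply: measurableI => //; exact: measurable_punctured_ball.
have mE : L2 (P `&` punctured_ball (n := n)) =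
    (L2 (P `&` small) + L2 (P `&` shell s))%E.
  rewrite [in LHS]ballE measureU//.
  - exact: measurableI.
  - by apply: measurableI => //; exact: measurable_shell.
  - apply/seteqP; split=> // u [[_ +] [_ +]]; rewrite /small /shell /= in_itv/=.
    by move=> /andP[_ us] /andP[su _]; move: (le_lt_trans us su); rewrite ltxx.
(* Finite volume allows the part in [small] to be cancelled in the extended reals. *)
have fin : L2 (P `&` punctured_ball (n := n)) \is a fin_num.
  by rewrite ge0_fin_numE// lebesgue2_punctured_ball_fin//; exact: subIsetr.
rewrite -/P EFinB muleBl// mul1e.
rewrite dil [X in (_ = X - _)%E]mE addeAC subee ?add0e//.
by rewrite -dil fin_numM.
Qed.

Lemma surface_measureE (s : R) (A : set T) : (0 < n)%N -> 0 < s < 1 -> measurable A ->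
  (surface_measure n A = ((n.*2)%:R / (1 - s ^+ n))%:E *
    L2 (@sphere_proj R n @^-1` A `&` shell s))%E.
Proof.
move=> n0 s01 mA; rewrite shell_cone// muleA -EFinM.
rewrite divfK// subr_eq0 eq_sym; move: s01 => /andP[s0 s1].
by rewrite lt_eqF// exprn_ilt1 ?ltW// -lt0n.
Qed.

(** By [s^n <= s], the exact factor [1 / (1 - s^n)] is enlarged to [1 / (1 - s)], the form that
    cancels against the volume of the fibres. *)
Lemma integral_surface_le (s : R) (G : T -> R) : (0 < n)%N -> 0 < s < 1 ->
  measurable_fun setT G -> (forall u, 0 <= G u) ->
  (\int[surface_measure n]_(u in sphere n) (G u)%:E <=
   ((n.*2)%:R / (1 - s))%:E *
     \int[L2]_(u in shell s) (G (sphere_proj u))%:E)%E.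
Proof.
move=> n0 /[dup] s01 /andP[s0 s1] mG G0.
have sn1 : s ^+ n <= s by rewrite -[X in _ <= X]expr1; apply: ler_wiXn2l => //; exact: ltW.
have c0 : 0 <= (n.*2)%:R / (1 - s ^+ n) by rewrite divr_ge0// subr_ge0; lra.
pose m : {measure set T -> \bar R} := mscale (NngNum c0)
  (measure_function_pushforward__canonical__measure_function_Measure
    (mrestr L2 (measurable_shell s)) (@measurable_sphere_proj R n)).
have mG' : measurable_fun setT (fun u => (G u)%:E) by exact/measurable_EFinP.
have mGp : measurable_fun setT (fun u => (G (sphere_proj u))%:E).
  exact: measurableT_comp mG' (@measurable_sphere_proj R n).
apply: le_trans (_ : \int[surface_measure n]_u (G u)%:E <= _)%E.
  apply: ge0_subset_integral => //; first exact: measurable_sphere.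
  by move=> u _; rewrite lee_fin.
rewrite (eq_measure_integral m); last first.
  by move=> A mA _; rewrite [LHS](surface_measureE n0 s01 mA).
rewrite ge0_integral_mscale; [|exact: measurableT|exact: mG'|]; last first.
  by move=> u _; rewrite lee_fin.
rewrite (ge0_integral_pushforward (@measurable_sphere_proj R n) _ measurableT mG'); last first.
  by move=> u _; rewrite lee_fin.
rewrite preimage_setT ge0_integral_mrestr//; last by move=> u; rewrite lee_fin.
apply: lee_wpmul2r; first by apply: integral_ge0 => u _; rewrite lee_fin.
rewrite lee_fin ler_wpM2l// lef_pV2 ?posrE; lra.
Qed.

(** The fibre over [y] is the annulus [s - |y|^2 < |z|^2 <= 1 - |y|^2]: its width in squared radius
    is [1 - s] whatever [y] is, and it is empty once [|y| > 1], which accounts for the indicator. *)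
Lemma xsection_shell_le (s : R) (y : 'rV[R]_n) : (2 <= n)%N -> 0 < s < 1 ->
  (L (xsection (shell s) y) <=
    ((1 - s) * n%:R * ball_volume n * \1_(cube 0 2) y)%:E)%E.
Proof.
move=> n2 /andP[s0 s1].
have secE : xsection (shell s) y =
    [set z | s - sqnorm_rV y < sqnorm_rV z <= 1 - sqnorm_rV y].
  apply/seteqP; split=> z; rewrite /xsection/= inE /shell/= /pair_sqnorm/=;
    by rewrite ltrBlDl lerBrDl.
have y0 := sqnorm_ge0 y.
have [y1|y1] := leP (sqnorm_rV y) 1; last first.
  rewrite secE (_ : mkset _ = set0) ?measure0.
    by rewrite lee_fin !mulr_ge0 ?ball_volume_ge0 ?indicE//; lra.
  by apply/seteqP; split=> // z /= /andP[_]; have := sqnorm_ge0 z; lra.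
rewrite secE indicE mem_set ?mulr1; last exact: sqball1_sub_cube.
have -> : 1 - s = (1 - sqnorm_rV y) - (s - sqnorm_rV y) by ring.
by apply: lebesgue_sqannulus => //; lra.
Qed.

Lemma integral_shell_fst_le (s : R) (g : 'rV[R]_n -> R) : (2 <= n)%N -> 0 < s < 1 ->
  measurable_fun setT g -> (forall y, 0 <= g y) ->
  (\int[L2]_(u in shell s) (g u.1)%:E <=
   ((1 - s) * n%:R * ball_volume n)%:E * \int[L]_(y in cube 0 2) (g y)%:E)%E.
Proof.
move=> n2 s01 mg g0.
have mg1 : measurable_fun setT (fun u : T => g u.1).
  exact: measurableT_comp mg measurable_fst.
have mG : measurable_fun setT (fun u : T => (g u.1 * \1_(shell s) u)%:E).
  by apply/measurable_EFinP/measurable_funM => //; exact: measurable_fun_indic_shell.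
rewrite (ge0_integral_indicl _ _ (measurable_shell s)) fubini_tonelli1//; last first.
  by move=> u; rewrite lee_fin mulr_ge0.
rewrite (ge0_integral_indicl _ _ (measurable_cube 0 2)).
have c0 : 0 <= (1 - s) * n%:R * ball_volume n.
  by rewrite !mulr_ge0 ?ball_volume_ge0//; lra.
have mgc : measurable_fun setT (fun y => (g y * \1_(cube 0 2) y)%:E).
  apply/measurable_EFinP/measurable_funM => //.
  by apply: measurable_indic; exact: measurable_cube.
rewrite -ge0_integralZl_EFin//; last by move=> y _; rewrite lee_fin mulr_ge0.
apply: ge0_le_integral => //.
- by move=> y _; apply: integral_ge0 => z _; rewrite lee_fin mulr_ge0.
- by apply: measurable_fun_fubini_tonelli_F => // u; rewrite lee_fin mulr_ge0.
- exact: emeasurable_funM.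
move=> y _; rewrite /fubini_F.
have mx : measurable (xsection (shell s) y) by apply: measurable_xsection; exact: measurable_shell.
rewrite (eq_integral (fun z => (g y)%:E * (\1_(xsection (shell s) y) z)%:E)%E); last first.
  by move=> z _; rewrite -EFinM !indicE mem_xsection.
rewrite ge0_integralZl_EFin//; last exact/measurable_EFinP/measurable_indic.
rewrite integral_indic//.
rewrite setIT; apply: le_trans (lee_wpmul2l _ (xsection_shell_le _ n2 s01)) _.
  by rewrite lee_fin.
by rewrite -!EFinM lee_fin mulrCA.
Qed.

(** The shell is symmetric under exchange of the factors; Tonelli in the two orders gives the same
    iterated integral. *)
Lemma integral_shell_snd (s : R) (g : 'rV[R]_n -> R) :
  measurable_fun setT g -> (forall y, 0 <= g y) ->
  (\int[L2]_(u in shell s) (g u.2)%:E = \int[L2]_(u in shell s) (g u.1)%:E)%E.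
Proof.
move=> mg g0.
have mi := measurable_fun_indic_shell s.
have mg1 : measurable_fun setT (fun u : T => (g u.1 * \1_(shell s) u)%:E).
  by apply/measurable_EFinP/measurable_funM => //; exact: measurableT_comp mg measurable_fst.
have mg2 : measurable_fun setT (fun u : T => (g u.2 * \1_(shell s) u)%:E).
  by apply/measurable_EFinP/measurable_funM => //; exact: measurableT_comp mg measurable_snd.
rewrite !(ge0_integral_indicl _ _ (measurable_shell s)).
have g1_ge0 u : (0 <= (g u.1 * \1_(shell s) u)%:E)%E by rewrite lee_fin mulr_ge0.
have g2_ge0 u : (0 <= (g u.2 * \1_(shell s) u)%:E)%E by rewrite lee_fin mulr_ge0.
rewrite (@fubini_tonelli1 _ _ _ _ _ L L _ mg2 g2_ge0) (@fubini_tonelli2 _ _ _ _ _ L L _ mg1 g1_ge0).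
apply: eq_integral => y _; rewrite /fubini_F /fubini_G.
apply: eq_integral => z _ /=; rewrite !indicE; congr (_ * (nat_of_bool _)%:R)%:E.
by apply/idP/idP; rewrite !inE /shell/= /pair_sqnorm/= addrC.
Qed.

End shell.

(** * Sphere averages of a function of one factor *)

Section sphere_average.
Context {R : realType} (n : nat).
Local Notation L := (@lebesgue_rV R n).
Local Notation T := ('rV[R]_n * 'rV[R]_n)%type.

(** Compactness of the closed cube in its filter form: around each of its points [P d] holds for all
    small [d > 0], hence some [d] serves the whole cube. *)
Lemma cube_unif_continuous (h : 'rV[R]_n -> R) (r e : R) : continuous h -> 0 < e ->
  exists2 d, 0 < d & forall y : 'rV[R]_n, (forall i, `|y ord0 i| <= r) ->
    forall y' : 'rV[R]_n, (forall i, `|y' ord0 i - y ord0 i| < d) -> `|h y' - h y| < e.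
Proof.
move=> ch e0.
pose K := [set v : 'rV[R]_n | forall i, `[- r, r]%classic (v ord0 i)].
have cK : compact K.
  by apply: (@rV_compact R n (fun=> `[- r, r]%classic)) => i; exact: segment_compact.
pose P (d : R) (y : 'rV[R]_n) :=
  forall y' : 'rV[R]_n, (forall i, `|y' ord0 i - y ord0 i| < d) -> `|h y' - h y| < e.
have Pnear : forall y, K y -> \forall y' \near y & d \near 0^'+, P d y'.
  move=> y _.
  have e2 : 0 < e / 2 by rewrite divr_gt0.
  have /nbhs_ballP[r0/= r0_gt0 yr0] : \forall y' \near y, `|h y - h y'| < e / 2.
    by have /cvgrPdist_lt := ch y; exact.
  have r02 : 0 < r0 / 2 by rewrite divr_gt0.
  have hy (y' : 'rV[R]_n) : (forall i, `|y' ord0 i - y ord0 i| < r0) -> `|h y - h y'| < e / 2.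
    move=> yy'; apply: yr0; split=> // i j.
    by rewrite (ord1 i) /ball/= distrC.
  exists (ball y (r0 / 2), `]0, r0 / 2[%classic) => /=.
    split; first exact: nbhsx_ballx.
    apply: filterS2 (nbhs_right_gt 0) (nbhs_right_lt r02) => d d0 d1.
    by rewrite /= ?in_itv/= d0.
  move=> [y1 d] /= [[_ yy1]]; rewrite ?in_itv/= => /andP[d0 d1] y2 y12.
  have y1i i : `|y1 ord0 i - y ord0 i| < r0 / 2.
    by have := yy1 ord0 i; rewrite /ball/= distrC.
  have h1 : `|h y - h y1| < e / 2.
    by apply: hy => i; apply: lt_trans (y1i i) _; lra.
  have h2 : `|h y - h y2| < e / 2.
    apply: hy => i; apply: le_lt_trans (ler_distD (y1 ord0 i) _ _) _.
    by have := y1i i; have := y12 i; lra.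
  apply: le_lt_trans (ler_distD (h y) _ _) _.
  by rewrite [`|h y2 - _|]distrC; lra.
have nearP : \forall d \near (0 : R)^'+, K `<=` P d.
  exact: ((compact_near_coveringP K).1 cK).
have [d [d0 dP]] := filter_ex (filterI (nbhs_right_gt (0 : R)) nearP).
exists d => // y yr; apply: dP => i.
by rewrite /= in_itv/= -ler_norml.
Qed.

(** With [r = |u|], a coordinate is multiplied by [1 / r] and is at most [r] in absolute value, so
    it moves by at most [1 - r]. Finally [r >= r^2 > s]. *)
Lemma sphere_proj_close (s : R) (u : T) i : 0 < s < 1 -> shell s u ->
  `|(sphere_proj u).1 ord0 i - u.1 ord0 i| <= 1 - s /\
  `|(sphere_proj u).2 ord0 i - u.2 ord0 i| <= 1 - s.
Proof.
move=> /andP[s0 s1] /andP[su u1].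
pose r := Num.sqrt (pair_sqnorm u).
have r2 : r ^+ 2 = pair_sqnorm u by rewrite sqr_sqrtr// pair_sqnorm_ge0.
have r0 : 0 < r by rewrite sqrtr_gt0; lra.
have r1 : r <= 1 by rewrite -sqrtr1 ler_wsqrtr.
have sr : s <= r by apply: le_trans (ltW su) _; rewrite -r2 expr2 ler_piMl// ltW.
have close (v : 'rV[R]_n) : sqnorm_rV v <= pair_sqnorm u ->
    `|(r^-1 *: v) ord0 i - v ord0 i| <= 1 - s.
  move=> vu; have vr : `|v ord0 i| <= r.
    rewrite -(@ler_pXn2r _ 2) ?nnegrE ?(ltW r0)// real_normK ?num_real// r2.
    exact: le_trans (sqr_coord_le_sqnorm v i) vu.
  have -> : (r^-1 *: v) ord0 i - v ord0 i = (r^-1 - 1) * v ord0 i by rewrite mxE mulrBl mul1r.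
  have r10 : 0 <= r^-1 - 1 by rewrite subr_ge0 invf_ge1.
  rewrite normrM (ger0_norm r10); apply: le_trans (ler_wpM2l r10 vr) _.
  by rewrite mulrBl mulVf ?gt_eqF// mul1r; lra.
by split; apply: close; rewrite /pair_sqnorm ?lerDl ?lerDr sqnorm_ge0.
Qed.

(** The product of [2n / (1 - s)], the cost of passing to the shell, and [(1 - s) n |B|], the bound
    for the fibres; the thickness cancels. *)
Definition sphere_const : R := (n.*2)%:R * n%:R * ball_volume n.

Lemma sphere_const_ge0 : 0 <= sphere_const.
Proof. by rewrite !mulr_ge0 ?ball_volume_ge0. Qed.

Section coordinate.
Variable c : T -> 'rV[R]_n.
Hypothesis c_meas : measurable_fun setT c.
Hypothesis c_sqnorm : forall u, sqnorm_rV (c u) <= pair_sqnorm u.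
Hypothesis c_proj : forall s u i, 0 < s < 1 -> shell s u ->
  `|c (sphere_proj u) ord0 i - c u ord0 i| <= 1 - s.
Hypothesis c_shell : forall s (g : 'rV[R]_n -> R), 0 < s < 1 ->
  measurable_fun setT g -> (forall y, 0 <= g y) ->
  (\int[L \x L]_(u in shell s) (g (c u))%:E <=
   ((1 - s) * n%:R * ball_volume n)%:E * \int[L]_(y in cube 0 2) (g y)%:E)%E.

(** Here [c] stands for either projection. On a thin shell [h (c (sphere_proj u))] exceeds [h (c u)]
    by at most [eta], so the sphere average is controlled by the shell integral of [h + eta], with a
    constant independent of the thickness; [eta] is arbitrarily small. *)
Lemma sphere_average_coord_le (h : 'rV[R]_n -> R) : (0 < n)%N ->
  continuous h -> (forall y, 0 <= h y) ->
  (\int[surface_measure n]_(u in sphere n) (h (c u))%:E <=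
   sphere_const%:E * \int[L]_(y in cube 0 2) (h y)%:E)%E.
Proof.
move=> n0 ch h0.
have mh := continuous_measurable_rV ch.
have vol0 : 0 < (2 *+ 2) ^+ n * sphere_const + 1.
  by rewrite ltr_wpDl// mulr_ge0 ?sphere_const_ge0// exprn_ge0.
apply/lee_addgt0Pr => e e0.
(* [cube 0 2] has volume [4^n], so [eta] contributes at most [e] in the end; the added 1 keeps the
   denominator positive. *)
pose eta := e / ((2 *+ 2) ^+ n * sphere_const + 1).
have eta0 : 0 < eta by rewrite divr_gt0.
have [d d0 hd] := cube_unif_continuous 1 ch eta0.
(* The second entry gives [1 - s < d], the first keeps [s] positive. *)
pose s := Num.max 2^-1 (1 - d / 2).
have s01 : 0 < s < 1 by rewrite /s lt_max gt_max; apply/andP; split; lra.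
have sd : 1 - s < d by rewrite /s ltrBlDl -ltrBlDr lt_max; lra.
have /andP[s0 s1] := s01.
apply: (@le_trans _ _ (((n.*2)%:R / (1 - s))%:E *
    \int[L \x L]_(u in shell s) (h (c (sphere_proj u)))%:E)%E).
  apply: (@integral_surface_le _ _ s (fun u => h (c u)) n0 s01) => //.
  exact: measurableT_comp mh c_meas.
apply: le_trans (_ : ((n.*2)%:R / (1 - s))%:E *
    \int[L \x L]_(u in shell s) (h (c u) + eta)%:E <= _)%E.
  rewrite lee_wpmul2l ?lee_fin ?divr_ge0//; first lra.
  apply: ge0_le_integral => //.
  - exact: measurable_shell.
  - by move=> u _; rewrite lee_fin /=.
  - apply/measurable_funTS/measurable_EFinP.
    apply: (measurableT_comp (f := h)) => //.
    exact: measurableT_comp c_meas (@measurable_sphere_proj R n).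
  - apply/measurable_funTS/measurable_EFinP/measurable_funD => //.
    exact: measurableT_comp mh c_meas.
  - move=> u su; rewrite lee_fin /= -lerBlDl.
    apply/ltW/(le_lt_trans (ler_norm _))/hd => i.
      have := le_trans (sqr_coord_le_sqnorm (c u) i) (le_trans (c_sqnorm u) (andP su).2).
      by rewrite -real_normK ?num_real// -[X in _ <= X](expr1n _ 2) ler_pXn2r ?nnegrE.
    by apply: le_lt_trans sd; exact: c_proj.
apply: le_trans (lee_wpmul2l _ (c_shell (g := fun y => h y + eta) s01 _ _)) _.
- by rewrite lee_fin divr_ge0//; lra.
- exact: measurable_funD.
- by move=> y; rewrite addr_ge0// ltW.
rewrite muleA -EFinM.
have -> : (n.*2)%:R / (1 - s) * ((1 - s) * n%:R * ball_volume n) = sphere_const.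
  by rewrite /sphere_const !mulrA divfK// gt_eqF//; lra.
under eq_integral do rewrite EFinD.
rewrite ge0_integralD//; first last.
- by move=> y _; rewrite lee_fin ltW.
- by apply/measurable_funTS/measurable_EFinP.
- by move=> y _; rewrite lee_fin.
- exact: measurable_cube.
rewrite ge0_muleDr ?integral_ge0//; last 2 first.
- by move=> y _; rewrite lee_fin.
- by move=> y _; rewrite lee_fin ltW.
rewrite leeD2l// (_ : (fun y => eta%:E) = cst eta%:E)// integral_cst; last exact: measurable_cube.
rewrite [X in (_ * (_ * X))%E](lebesgue_cube 0) // -!EFinM lee_fin.
rewrite mulrCA /eta -mulrA ler_piMr ?(ltW e0)//.
by rewrite mulrC ler_pdivrMr// mul1r mulrC lerDl.
Qed.

End coordinate.

Lemma sphere_average_fst_le (h : 'rV[R]_n -> R) : (2 <= n)%N ->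
  continuous h -> (forall y, 0 <= h y) ->
  (\int[surface_measure n]_(u in sphere n) (h u.1)%:E <=
   sphere_const%:E * \int[L]_(y in cube 0 2) (h y)%:E)%E.
Proof.
move=> n2; apply: sphere_average_coord_le => //.
- by move=> u; rewrite /pair_sqnorm lerDl sqnorm_ge0.
- by move=> s u i s01 su; have [] := sphere_proj_close i s01 su.
- by move=> s g s01 mg g0; exact: integral_shell_fst_le.
- exact: ltnW.
Qed.

Lemma sphere_average_snd_le (h : 'rV[R]_n -> R) : (2 <= n)%N ->
  continuous h -> (forall y, 0 <= h y) ->
  (\int[surface_measure n]_(u in sphere n) (h u.2)%:E <=
   sphere_const%:E * \int[L]_(y in cube 0 2) (h y)%:E)%E.
Proof.
move=> n2; apply: sphere_average_coord_le => //.
- by move=> u; rewrite /pair_sqnorm lerDr sqnorm_ge0.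
- by move=> s u i s01 su; have [] := sphere_proj_close i s01 su.
- by move=> s g s01 mg g0; rewrite integral_shell_snd//; exact: integral_shell_fst_le.
- exact: ltnW.
Qed.

End sphere_average.

(** Where [a x > 0] the power function is differentiable; at a zero of [a], the bound
    [a y < e^(1/r)] gives [(a y)^r < e]. Continuity of the powers of [|f|] and [|g|] is required by
    the shell argument. *)
Lemma continuous_powR_comp {R : realType} (T : topologicalType) (a : T -> R) (r : R) :
  0 < r -> (forall x, 0 <= a x) -> continuous a -> continuous (fun x => a x `^ r).
Proof.
move=> r0 a0 ca x.
have [ax0|ax_gt0] := leP (a x) 0; last first.
  apply: (@continuous_comp _ _ _ a (@powR R ^~ r)); first exact: ca.
  apply/differentiable_continuous/derivable1_diffP/derivable_powR.
  by rewrite in_itv/= andbT.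
have ax : a x = 0 by apply/eqP; rewrite eq_le ax0 a0.
apply/cvgrPdist_lt => e e0; rewrite ax powR0 ?gt_eqF//.
have er0 : 0 < e `^ r^-1 by rewrite powR_gt0.
have /cvgrPdist_lt/(_ _ er0) := ca x; rewrite ax.
apply: filterS => y; rewrite !sub0r !normrN ger0_norm// ger0_norm ?powR_ge0// => ay.
have := gt0_ltr_powR r0 _ _ ay; rewrite -powRrM mulVf ?gt_eqF// powRr1 ?(ltW e0)//.
by apply; rewrite nnegrE// ltW.
Qed.

(** * Domination of sphere averages by the maximal function *)

Section rV.
Context {R : realType} (n : nat).
Local Notation L := (@lebesgue_rV R n).
Local Notation T := ('rV[R]_n * 'rV[R]_n)%type.

(** Otherwise [h > c] on a cube of positive measure. This turns an essential supremum into a bound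
    everywhere, and a zero norm into the zero function. *)
Lemma continuous_ae_le (h : 'rV[R]_n -> R) (c : R) : continuous h ->
  {ae L, forall x, h x <= c} -> forall x, h x <= c.
Proof.
move=> ch [N [mN N0 hN]] x; rewrite leNgt; apply/negP => cx.
have /nbhs_ballP[r/= r0 hr] : \forall y \near x, c < h y.
  by move: (ch x) => /cvgr_gt; exact.
have sub : cube x r `<=` N.
  move=> v xv; apply: hN => /=; apply/negP; rewrite -ltNge; apply: hr.
  by split=> // i j; rewrite (ord1 i) /ball/= distrC.
have : (L (cube x r) <= L N)%E.
  by apply: le_measure; rewrite ?inE//; exact: measurable_cube.
rewrite [leLHS](lebesgue_cube x (ltW r0)) [leRHS]N0 lee_fin leNgt exprn_gt0//.
by rewrite pmulrn_lgt0.
Qed.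

Lemma continuous_sub_scale (h : 'rV[R]_n -> R) (x : 'rV[R]_n) (t : R) :
  continuous h -> continuous (fun y : 'rV[R]_n => h (x - t *: y)).
Proof.
move=> ch y; apply: (@continuous_comp _ _ _ (fun y : 'rV[R]_n => x - t *: y) h); last exact: ch.
by apply: continuousB; [exact: cst_continuous|exact: scaler_continuous].
Qed.

Section maximal.
Variables (h : 'rV[R]_n -> R) (M : R).
Hypothesis ch : continuous h.
Hypothesis h0 : forall y, 0 <= h y.
Hypothesis hM : forall y, h y <= M.
Let mh := continuous_measurable_rV ch.

(** The substitution [v = x - t y] sends [cube 0 2] to [cube x (2 t)]. Its Jacobian [t^n] cancels
    against the factor [(12 t)^n] of the maximal bound, leaving a constant independent of [t]. *)
Lemma integral_cube_sub_scale (x : 'rV[R]_n) (t : R) : 0 < t -> exists N,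
  (\int[L]_(y in cube 0 2) (h (x - t *: y)%R)%:E <=
   (12 ^+ n * rat_maximal h N x)%:E)%E.
Proof.
move=> t0; have t20 : 0 < 2 * t by rewrite mulr_gt0.
have [N xN] := integral_cube_le_maximal mh h0 hM x t20.
exists N; move: xN.
have nt0 : - t != 0 by rewrite oppr_eq0 gt_eqF.
have mhE : measurable_fun setT (fun y => (h y)%:E) by exact/measurable_EFinP.
rewrite (ge0_integral_affine_rV x nt0 (measurable_cube x (2 * t)) mhE); last first.
  by move=> y; rewrite lee_fin.
have -> : (fun y => x + - t *: y) @^-1` cube x (2 * t) = cube 0 2.
  apply/seteqP; split=> y /= + i => /(_ i); rewrite !mxE subr0;
    by rewrite addrAC subrr add0r normrM normrN (gtr0_norm t0) mulrC ltr_pM2r.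
under eq_integral do rewrite scaleNr.
rewrite normrN gtr0_norm// (_ : 6 * (2 * t) = t * 12); last by ring.
rewrite exprMn -mulrA [X in (_ <= X)%E]EFinM lee_pmul2l ?lte_fin ?exprn_gt0//.
Qed.

Lemma measurable_maximal_pow p : 0 < p -> measurable_fun setT (maximal_pow h p).
Proof.
move=> p0; apply: (emeasurable_fun_cvg (fun N y => (rat_maximal h N y `^ p)%:E)).
  move=> N; apply/measurable_EFinP/(measurableT_comp (measurable_powR _)).
  exact: measurable_rat_maximal.
move=> y _; apply: ereal_nondecreasing_cvgn => i j ij.
rewrite lee_fin; apply: ge0_ler_powR; rewrite ?nnegrE ?(ltW p0) ?rat_maximal_ge0//.
exact: rat_maximal_homo.
Qed.

Lemma maximal_pow_ge0 p y : (0 <= maximal_pow h p y)%E.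
Proof. by apply: le_trans (le_maximal_pow h p 0 y); rewrite lee_fin powR_ge0. Qed.

End maximal.

Definition average_const : R := sphere_const n * 12 ^+ n.

Lemma average_const_ge0 : 0 <= average_const.
Proof. by rewrite mulr_ge0 ?sphere_const_ge0// exprn_ge0. Qed.

Lemma sphere_average_fst_maximal (h : 'rV[R]_n -> R) (M : R) x t : (2 <= n)%N ->
  continuous h -> (forall y, 0 <= h y) -> (forall y, h y <= M) -> 0 < t ->
  exists N, (\int[surface_measure n]_(u in sphere n) (h (x - t *: u.1)%R)%:E <=
    (average_const * rat_maximal h N x)%:E)%E.
Proof.
move=> n2 ch h0 hM t0; have [N xN] := integral_cube_sub_scale ch h0 hM x t0.
have cht := continuous_sub_scale (x := x) (t := t) ch.
exists N; apply: le_trans (sphere_average_fst_le n2 cht _) _ => //.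
by rewrite /average_const -mulrA [X in (_ <= X)%E]EFinM lee_wpmul2l// lee_fin sphere_const_ge0.
Qed.

Lemma sphere_average_snd_maximal (h : 'rV[R]_n -> R) (M : R) x t : (2 <= n)%N ->
  continuous h -> (forall y, 0 <= h y) -> (forall y, h y <= M) -> 0 < t ->
  exists N, (\int[surface_measure n]_(u in sphere n) (h (x - t *: u.2)%R)%:E <=
    (average_const * rat_maximal h N x)%:E)%E.
Proof.
move=> n2 ch h0 hM t0; have [N xN] := integral_cube_sub_scale ch h0 hM x t0.
have cht := continuous_sub_scale (x := x) (t := t) ch.
exists N; apply: le_trans (sphere_average_snd_le n2 cht _) _ => //.
by rewrite /average_const -mulrA [X in (_ <= X)%E]EFinM lee_wpmul2l// lee_fin sphere_const_ge0.
Qed.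

(** The supremum over [S x] may be uncountable and is not assumed measurable in [x]. Its [q]-th
    power is compared pointwise with the majorant [Psi], and the integrals are compared without
    measurability. *)
Lemma Lnorm_ereal_sup_le (S : 'rV[R]_n -> set R) (Psi : 'rV[R]_n -> \bar R) (q c : R) :
  0 < q -> 0 <= c -> (forall x, S x !=set0) -> (forall x e, S x e -> 0 <= e) ->
  (forall x e, S x e -> ((e `^ q)%:E <= Psi x)%E) ->
  (\int[L]_x Psi x <= (c `^ q)%:E)%E ->
  (Lnorm L q%:E (fun x => ereal_sup [set e%:E | e in S x]) <= c%:E)%E.
Proof.
move=> q0 c0 Sne S0 SPsi Psic.
rewrite unlock /Lnorm.
have sup0 x : (0 <= ereal_sup [set e%:E | e in S x])%E.
  have [e Sxe] := Sne x.
  apply: le_trans (_ : e%:E <= _)%E; first by rewrite lee_fin; exact: S0 Sxe.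
  by apply: ereal_sup_ubound; exists e.
have -> : c%:E = ((c `^ q)%:E `^ q^-1)%E.
  by rewrite poweR_EFin -powRrM mulfV ?gt_eqF// powRr1.
have I0 : (0 <= \int[L]_x (`|ereal_sup [set e%:E | e in S x]| `^ q))%E.
  by apply: integral_ge0 => x _; exact: poweR_ge0.
apply: gt0_ler_poweR; rewrite ?invr_ge0 ?(ltW q0)// ?in_itv/= ?leey ?andbT ?lee_fin ?powR_ge0//.
apply: le_trans Psic; apply: ge0_le_integral_nonmeasurable.
  by move=> x; exact: poweR_ge0.
move=> x; rewrite gee0_abs//.
have Psi0 : (0 <= Psi x)%E.
  have [e Sxe] := Sne x; apply: le_trans (SPsi x e Sxe).
  by rewrite lee_fin powR_ge0.
(* Writing [Psi x] as a [q]-th power removes the exponent from the supremum, which can then be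
   bounded element by element. *)
have -> : Psi x = ((Psi x `^ q^-1) `^ q)%E.
  by rewrite -poweRrM mulVf ?gt_eqF// poweRe1.
apply: gt0_ler_poweR; rewrite ?(ltW q0)// ?in_itv/= ?leey ?andbT ?poweR_ge0//.
apply: ge_ereal_sup => _ [e Sxe <-].
have -> : e%:E = ((e `^ q)%:E `^ q^-1)%E.
  by rewrite poweR_EFin -powRrM mulfV ?gt_eqF// powRr1//; exact: S0 Sxe.
apply: gt0_ler_poweR; rewrite ?invr_ge0 ?(ltW q0)// ?in_itv/= ?leey ?andbT ?lee_fin ?powR_ge0//.
exact: SPsi.
Qed.

End rV.

(** * The bilinear estimate *)

Section estimates.
Context {R : realType} (n : nat).
Hypothesis n2 : (2 <= n)%N.
Local Notation L := (@lebesgue_rV R n).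
Local Notation T := ('rV[R]_n * 'rV[R]_n)%type.
Local Notation sigma := (@surface_measure R n).
Local Notation K := (@average_const R n).

(** Bounds the [q]-th power of the norm of the maximal operator, hence the exponent [q^-1] on it in
    the final constants. *)
Definition Lp_const (q : R) : R := maximal_const q (3 ^+ n) `^ q.

Lemma Lp_const_ge0 q : 0 <= Lp_const q. Proof. exact: powR_ge0. Qed.

(** The linear estimate behind the cases with exactly one infinite exponent: the supremum of the
    other function is part of [c]. *)
Lemma Lnorm_sup_rat_maximal_le (S : 'rV[R]_n -> set R) (a : 'rV[R]_n -> R)
    (M q c alpha : R) :
  1 < q -> 0 <= c -> 0 <= alpha -> continuous a -> (forall y, 0 <= a y) ->
  (forall y, a y <= M) -> (forall x, S x !=set0) ->
  (forall x e, S x e -> 0 <= e /\ exists N, e <= c * rat_maximal a N x) ->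
  (\int[L]_x (a x `^ q)%:E = (alpha `^ q)%:E)%E ->
  (Lnorm L q%:E (fun x => ereal_sup [set e%:E | e in S x]) <=
    (c * Lp_const q `^ q^-1 * alpha)%:E)%E.
Proof.
move=> q1 c0 alpha0 ca a0 aM Sne Sc aE.
have q0 : 0 < q by lra.
have ma := continuous_measurable_rV ca.
pose Psi x := ((c `^ q)%:E * maximal_pow a q x)%E.
apply: (Lnorm_ereal_sup_le (Psi := Psi)) => //.
- by rewrite !mulr_ge0 ?powR_ge0.
- by move=> x e /Sc[].
- move=> x e /Sc[e0 [N eN]].
  apply: le_trans (lee_wpmul2l _ (le_maximal_pow a q N x)); last first.
    by rewrite lee_fin powR_ge0.
  rewrite -EFinM lee_fin -powRM ?rat_maximal_ge0//.
  apply: ge0_ler_powR; rewrite ?nnegrE ?(ltW q0)//.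
  by rewrite mulr_ge0 ?rat_maximal_ge0.
- rewrite /Psi ge0_integralZl_EFin ?powR_ge0//; last 2 first.
  + by move=> x _; exact: maximal_pow_ge0.
  + exact: measurable_maximal_pow.
  rewrite !powRM ?mulr_ge0 ?powR_ge0// -powRrM mulVf ?gt_eqF// powRr1 ?Lp_const_ge0//.
  rewrite -mulrA EFinM lee_wpmul2l ?lee_fin ?powR_ge0//.
  apply: le_trans (integral_maximal_pow ma a0 aM q1) _.
  by rewrite aE -EFinM.
Qed.

Lemma powR_add_le (x y q : R) : 0 <= x -> 0 <= y -> 0 < q ->
  (x + y) `^ q <= 2 `^ q * (x `^ q + y `^ q).
Proof.
move=> x0 y0 q0; have xy0 : 0 <= x + y by rewrite addr_ge0.
have [xy|yx] := leP x y.
  apply: le_trans (_ : (2 * y) `^ q <= _).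
    by apply: ge0_ler_powR; rewrite ?nnegrE ?(ltW q0)//; lra.
  by rewrite powRM// ler_wpM2l ?powR_ge0// lerDr powR_ge0.
apply: le_trans (_ : (2 * x) `^ q <= _).
  by apply: ge0_ler_powR; rewrite ?nnegrE ?(ltW q0)//; lra.
by rewrite powRM// ler_wpM2l ?powR_ge0// lerDl powR_ge0.
Qed.

Lemma measurable_fst_arg (h : 'rV[R]_n -> R) x t : continuous h ->
  measurable_fun setT (fun u : T => h (x - t *: u.1)).
Proof.
move=> ch.
have mh := continuous_measurable_rV (continuous_sub_scale (x := x) (t := t) ch).
exact: measurableT_comp mh measurable_fst.
Qed.

Lemma measurable_snd_arg (h : 'rV[R]_n -> R) x t : continuous h ->
  measurable_fun setT (fun u : T => h (x - t *: u.2)).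
Proof.
move=> ch.
have mh := continuous_measurable_rV (continuous_sub_scale (x := x) (t := t) ch).
exact: measurableT_comp mh measurable_snd.
Qed.

(* Young's inequality with the normalized functions a/alpha and b/beta. *)
Lemma integral_sphere_mul_le (a b : 'rV[R]_n -> R) (r r' alpha beta : R) x t :
  continuous a -> (forall y, 0 <= a y) -> continuous b -> (forall y, 0 <= b y) ->
  1 <= r -> 1 <= r' -> r^-1 + r'^-1 = 1 -> 0 < alpha -> 0 < beta ->
  (\int[sigma]_(u in sphere n) (a (x - t *: u.1) * b (x - t *: u.2))%:E <=
   (alpha * beta)%:E *
   ((alpha `^ (- r))%:E * \int[sigma]_(u in sphere n) (a (x - t *: u.1) `^ r)%:E +
    (beta `^ (- r'))%:E * \int[sigma]_(u in sphere n) (b (x - t *: u.2) `^ r')%:E))%E.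
Proof.
move=> ca a0 cb b0 r1 r'1 rr' alpha0 beta0.
have r0 : 0 < r by lra.
have r'0 : 0 < r' by lra.
have ma := measurable_fst_arg x t ca.
have mb := measurable_snd_arg x t cb.
have mar := measurable_fst_arg x t (continuous_powR_comp r0 a0 ca).
have mbr := measurable_snd_arg x t (continuous_powR_comp r'0 b0 cb).
rewrite -!ge0_integralZl_EFin ?powR_ge0//; first last.
- exact/measurable_funTS/measurable_EFinP.
- by move=> u _; rewrite lee_fin powR_ge0.
- exact: measurable_sphere.
- exact/measurable_funTS/measurable_EFinP.
- by move=> u _; rewrite lee_fin powR_ge0.
- exact: measurable_sphere.
rewrite -ge0_integralD//; first last.
- by apply: emeasurable_funM => //; exact/measurable_funTS/measurable_EFinP.
- by move=> u _; rewrite lee_fin mulr_ge0 ?powR_ge0.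
- by apply: emeasurable_funM => //; exact/measurable_funTS/measurable_EFinP.
- by move=> u _; rewrite lee_fin mulr_ge0 ?powR_ge0.
- exact: measurable_sphere.
rewrite -ge0_integralZl_EFin ?mulr_ge0 ?(ltW alpha0) ?(ltW beta0)//; first last.
- by apply: emeasurable_funD; apply: emeasurable_funM => //;
    exact/measurable_funTS/measurable_EFinP.
- by move=> u _; rewrite -!EFinM -EFinD lee_fin addr_ge0// mulr_ge0 ?powR_ge0.
- exact: measurable_sphere.
apply: ge0_le_integral => //.
- exact: measurable_sphere.
- by move=> u _; rewrite lee_fin mulr_ge0.
- by apply/measurable_funTS/measurable_EFinP; exact: measurable_funM.
- apply: emeasurable_funM => //.
  by apply: emeasurable_funD; apply: emeasurable_funM => //;
    exact/measurable_funTS/measurable_EFinP.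
move=> u _; rewrite -!EFinM -?EFinD -?EFinM lee_fin.
set A := a _; set B := b _.
have A0 : 0 <= A by exact: a0.
have B0 : 0 <= B by exact: b0.
have -> : A * B = alpha * beta * ((A / alpha) * (B / beta)).
  by field; rewrite !gt_eqF.
rewrite ler_wpM2l ?mulr_ge0 ?(ltW alpha0) ?(ltW beta0)//.
have Aa0 : 0 <= A / alpha by rewrite divr_ge0// ltW.
have Bb0 : 0 <= B / beta by rewrite divr_ge0// ltW.
apply: le_trans (conjugate_powR Aa0 Bb0 r0 r'0 rr') _.
have powdiv (z w s : R) : 0 <= z -> 0 < w -> (z / w) `^ s = w `^ (- s) * z `^ s.
  move=> z0 w0; rewrite powRM ?invr_ge0 ?(ltW w0)// mulrC powRN.
  by rewrite -powR_inv1 ?(ltW w0)// -powRrM mulN1r powRN.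
(* The factors [1 / r] and [1 / r'] of Young's inequality are at most 1 and are dropped. *)
rewrite !powdiv//; apply: lerD.
  by rewrite ler_pdivrMr// ler_peMr// mulr_ge0 ?powR_ge0.
by rewrite ler_pdivrMr// ler_peMr// mulr_ge0 ?powR_ge0.
Qed.

Lemma ge0_integral_lincomb_le (F G : 'rV[R]_n -> \bar R) (k u v D : R) :
  0 <= k -> 0 <= u -> 0 <= v -> measurable_fun setT F -> measurable_fun setT G ->
  (forall x, 0 <= F x)%E -> (forall x, 0 <= G x)%E ->
  (u%:E * \int[L]_x F x <= D%:E)%E -> (v%:E * \int[L]_x G x <= D%:E)%E ->
  (\int[L]_x (k%:E * (u%:E * F x + v%:E * G x)) <= (k * (2 * D))%:E)%E.
Proof.
move=> k0 u0 v0 mF mG F0 G0 uF vG.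
have uF0 x : (0 <= u%:E * F x)%E by rewrite mule_ge0.
have vG0 x : (0 <= v%:E * G x)%E by rewrite mule_ge0.
have muF := measurable_funeM u%:E mF.
have mvG := measurable_funeM v%:E mG.
rewrite ge0_integralZl_EFin//; last 2 first.
- by move=> x _; rewrite adde_ge0.
- exact: emeasurable_funD.
rewrite ge0_integralD// !ge0_integralZl_EFin// EFinM lee_wpmul2l//.
by rewrite mulr_natl mulr2n EFinD; exact: leeD.
Qed.

Lemma Lnorm_sup_bilinear_le (S : 'rV[R]_n -> set R) (a b : 'rV[R]_n -> R)
    (Ma Mb q q1 q2 alpha beta : R) :
  1 < q -> 1 < q1 -> 1 < q2 -> q1^-1 + q2^-1 = q^-1 ->
  continuous a -> (forall y, 0 <= a y) -> (forall y, a y <= Ma) ->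
  continuous b -> (forall y, 0 <= b y) -> (forall y, b y <= Mb) ->
  0 < alpha -> 0 < beta ->
  (\int[L]_x (a x `^ q1)%:E = (alpha `^ q1)%:E)%E ->
  (\int[L]_x (b x `^ q2)%:E = (beta `^ q2)%:E)%E ->
  (forall x, S x !=set0) ->
  (forall x e, S x e -> 0 <= e /\ exists2 t, 0 < t &
    (e%:E <= 2%:E * \int[sigma]_(u in sphere n)
      (a (x - t *: u.1) * b (x - t *: u.2))%:E)%E) ->
  (Lnorm L q%:E (fun x => ereal_sup [set e%:E | e in S x]) <=
    (4 * K * (2 * Lp_const q) `^ q^-1 * alpha * beta)%:E)%E.
Proof.
move=> q_1 q1_1 q2_1 q12 ca a0 aM cb b0 bM alpha0 beta0 aE bE Sne Sab.
have q0 : 0 < q by lra.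
have q10 : 0 < q1 by lra.
have q20 : 0 < q2 by lra.
pose r := q1 / q; pose r' := q2 / q.
have r0 : 0 < r by rewrite divr_gt0.
have r'0 : 0 < r' by rewrite divr_gt0.
have rr' : r^-1 + r'^-1 = 1.
  by rewrite /r /r' !invf_div -mulrDr q12 mulfV// gt_eqF.
have rV0 : 0 < r^-1 by rewrite invr_gt0.
have r'V0 : 0 < r'^-1 by rewrite invr_gt0.
have r1 : 1 <= r by rewrite -invf_le1//; lra.
have r'1 : 1 <= r' by rewrite -invf_le1//; lra.
have rq : r * q = q1 by rewrite divfK// gt_eqF.
have r'q : r' * q = q2 by rewrite divfK// gt_eqF.
pose ar y := a y `^ r; pose br y := b y `^ r'.
have car : continuous ar by exact: continuous_powR_comp.
have cbr : continuous br by exact: continuous_powR_comp.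
have ar0 y : 0 <= ar y by exact: powR_ge0.
have br0 y : 0 <= br y by exact: powR_ge0.
have arM y : ar y <= Ma `^ r.
  by apply: ge0_ler_powR; rewrite ?nnegrE ?(ltW r0) ?(le_trans (a0 y)).
have brM y : br y <= Mb `^ r'.
  by apply: ge0_ler_powR; rewrite ?nnegrE ?(ltW r'0) ?(le_trans (b0 y)).
have mar := continuous_measurable_rV car.
have mbr := continuous_measurable_rV cbr.
have K0 : 0 <= K by exact: average_const_ge0.
have D0 := Lp_const_ge0 q.
(* One factor 2 comes from the hypothesis on [S], the other from the [q]-th power of a sum in
   [powR_add_le]. *)
pose c := 4 * K * alpha * beta.
have alpha_ge0 := ltW alpha0.
have beta_ge0 := ltW beta0.
have c0 : 0 <= c by apply: mulr_ge0 => //; apply: mulr_ge0 => //; exact: mulr_ge0.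
(* The weights are the [q]-th powers of [alpha^(-r)] and [beta^(-r')], since [r q = q1] and
   [r' q = q2]. *)
pose Psi x := ((c `^ q)%:E * ((alpha `^ (- q1))%:E * maximal_pow ar q x +
  (beta `^ (- q2))%:E * maximal_pow br q x))%E.
have Phia0 x : (0 <= (alpha `^ (- q1))%:E * maximal_pow ar q x)%E.
  by rewrite mule_ge0 ?lee_fin ?powR_ge0 ?maximal_pow_ge0.
have Phib0 x : (0 <= (beta `^ (- q2))%:E * maximal_pow br q x)%E.
  by rewrite mule_ge0 ?lee_fin ?powR_ge0 ?maximal_pow_ge0.
have mPhia : measurable_fun setT (maximal_pow ar q) by exact: measurable_maximal_pow.
have mPhib : measurable_fun setT (maximal_pow br q) by exact: measurable_maximal_pow.
apply: (Lnorm_ereal_sup_le (Psi := Psi)) => //.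
- apply: mulr_ge0 => //; apply: mulr_ge0 => //; apply: mulr_ge0; last exact: powR_ge0.
  exact: mulr_ge0.
- by move=> x e /Sab[].
- move=> x e /Sab[e0 [t t0 et]].
  have [N1 N1P] := sphere_average_fst_maximal x n2 car ar0 arM t0.
  have [N2 N2P] := sphere_average_snd_maximal x n2 cbr br0 brM t0.
  set A := rat_maximal ar N1 x in N1P; set B := rat_maximal br N2 x in N2P.
  have A0 : 0 <= A by exact: rat_maximal_ge0.
  have B0 : 0 <= B by exact: rat_maximal_ge0.
  have eAB : e <= 2 * alpha * beta * K * (alpha `^ (- r) * A + beta `^ (- r') * B).
    rewrite -lee_fin; apply: le_trans et _.
    have young := integral_sphere_mul_le x t ca a0 cb b0 r1 r'1 rr' alpha0 beta0.
    apply: le_trans (lee_wpmul2l _ young) _.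
      by rewrite lee_fin.
    rewrite muleA -EFinM.
    apply: (@le_trans _ _ ((2 * (alpha * beta))%:E * ((alpha `^ (- r))%:E * (K * A)%:E +
        (beta `^ (- r'))%:E * (K * B)%:E))%E).
      rewrite lee_wpmul2l ?lee_fin ?mulr_ge0 ?(ltW alpha0) ?(ltW beta0)//.
      by apply: leeD; rewrite lee_wpmul2l ?lee_fin ?powR_ge0.
    rewrite -!EFinM -?EFinD -?EFinM lee_fin le_eqVlt; apply/orP; left; apply/eqP; ring.
  have X0 : 0 <= alpha `^ (- r) * A by rewrite mulr_ge0 ?powR_ge0.
  have Y0 : 0 <= beta `^ (- r') * B by rewrite mulr_ge0 ?powR_ge0.
  have k0 : 0 <= 2 * alpha * beta * K.
    by apply: mulr_ge0 => //; apply: mulr_ge0 => //; exact: mulr_ge0.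
  apply: (@le_trans _ _ ((c `^ q)%:E * ((alpha `^ (- q1))%:E * (A `^ q)%:E +
      (beta `^ (- q2))%:E * (B `^ q)%:E))%E); last first.
    rewrite lee_wpmul2l ?lee_fin ?powR_ge0//.
    by apply: leeD; rewrite lee_wpmul2l ?lee_fin ?powR_ge0//; exact: le_maximal_pow.
  rewrite -!EFinM -?EFinD -?EFinM lee_fin.
  apply: (@le_trans _ _ ((2 * alpha * beta * K * (alpha `^ (- r) * A + beta `^ (- r') * B)) `^ q)).
    by apply: ge0_ler_powR; rewrite ?nnegrE ?(ltW q0)// mulr_ge0// addr_ge0.
  rewrite powRM ?addr_ge0//.
  have -> : c `^ q = (2 * alpha * beta * K) `^ q * 2 `^ q.
    by rewrite -powRM//; congr (_ `^ _); rewrite /c; ring.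
  rewrite -[X in _ <= X]mulrA ler_wpM2l ?powR_ge0//.
  apply: le_trans (powR_add_le X0 Y0 q0) _.
  rewrite !powRM ?powR_ge0// -!powRrM !mulNr rq r'q.
  exact: lexx.
- have -> : 4 * K * (2 * Lp_const q) `^ q^-1 * alpha * beta = c * (2 * Lp_const q) `^ q^-1.
    by rewrite /c; ring.
  rewrite powRM ?powR_ge0// -powRrM mulVf ?gt_eqF// powRr1 ?mulr_ge0//.
  (* The maximal theorem in [L^q] for the power [h^s] returns the integral of [h^s1], equal to
     [w^s1], which the weight cancels. Each of the two functions therefore contributes [Lp_const q],
     whence the 2 under the root. *)
  have norm (h hr : 'rV[R]_n -> R) (s s1 w : R) : 0 < w -> s * q = s1 ->
      (forall y, hr y = h y `^ s) ->
      (\int[L]_y maximal_pow hr q y <= (Lp_const q)%:E * \int[L]_y (hr y `^ q)%:E)%E ->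
      (\int[L]_x (h x `^ s1)%:E = (w `^ s1)%:E)%E ->
      ((w `^ (- s1))%:E * \int[L]_y maximal_pow hr q y <= (Lp_const q)%:E)%E.
    move=> w0 sq hrE hmax hE.
    apply: le_trans (lee_wpmul2l _ hmax) _; first by rewrite lee_fin powR_ge0.
    under eq_integral do rewrite hrE -powRrM sq.
    rewrite hE -!EFinM lee_fin mulrCA -powRD ?addNr ?powRr0 ?mulr1//.
    by rewrite eqxx gt_eqF.
  apply: ge0_integral_lincomb_le => //.
  + exact: powR_ge0.
  + exact: powR_ge0.
  + exact: powR_ge0.
  + by move=> x; exact: maximal_pow_ge0.
  + by move=> x; exact: maximal_pow_ge0.
  + by apply: (norm a ar r) => //; exact: integral_maximal_pow.
  + by apply: (norm b br r') => //; exact: integral_maximal_pow.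
Qed.

End estimates.

(** * Complex-valued Schwartz functions *)

Section complex_functions.
Context {R : realType} (n : nat).
Local Notation L := (@lebesgue_rV R n).
Local Notation T := ('rV[R]_n * 'rV[R]_n)%type.
Local Notation sigma := (@surface_measure R n).

Lemma Re_le_normc (z : R[i]) : `|complex.Re z| <= normc z.
Proof.
case: z => x y; rewrite /normc/= -sqrtr_sqr ler_wsqrtr// lerDl; exact: sqr_ge0.
Qed.

Lemma Im_le_normc (z : R[i]) : `|complex.Im z| <= normc z.
Proof.
case: z => x y; rewrite /normc/= -sqrtr_sqr ler_wsqrtr// lerDr; exact: sqr_ge0.
Qed.

Lemma normc_le (x y : R) : normc (Complex x y) <= `|x| + `|y|.
Proof.
rewrite /normc -(ger0_norm (addr_ge0 (normr_ge0 x) (normr_ge0 y))) -sqrtr_sqr.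
apply: ler_wsqrtr; rewrite sqrrD !real_normK ?num_real// -addrA.
by rewrite [X in _ <= _ + X]addrC addrA lerDl mulrn_wge0.
Qed.

Lemma normc_ge0 (z : R[i]) : 0 <= normc z.
Proof. by case: z => x y; exact: sqrtr_ge0. Qed.

Lemma real_schwartz_continuous (h : 'rV[R]_n -> R) : real_schwartz h -> continuous h.
Proof. by move=> [/(_ [::])[]]. Qed.

Lemma real_schwartz_bounded (h : 'rV[R]_n -> R) : real_schwartz h ->
  exists M, forall x, `|h x| <= M.
Proof.
move=> [_ /(_ (fun=> 0%N) [::])[M hM]]; exists M => x.
have := hM x; rewrite /monomial_rV /= (eq_bigr (fun=> 1)) ?big1 ?mul1r//.
Qed.

Lemma schwartz_normc_continuous (f : 'rV[R]_n -> R[i]) : schwartz f ->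
  continuous (fun x => normc (f x)).
Proof.
move=> [/real_schwartz_continuous cRe /real_schwartz_continuous cIm].
rewrite (_ : (fun x => _) =
    fun x => Num.sqrt (complex.Re (f x) ^+ 2 + complex.Im (f x) ^+ 2)); last first.
  by apply/funext => x; case: (f x).
move=> x; apply: (@continuous_comp _ _ _
  (fun x => complex.Re (f x) ^+ 2 + complex.Im (f x) ^+ 2) (@Num.sqrt R)); last first.
  exact: sqrt_continuous.
have sq (h : 'rV[R]_n -> R) : continuous h -> continuous (fun y => h y ^+ 2).
  move=> ch y; apply: (@continuous_comp _ _ _ h (fun z : R => z ^+ 2)); first exact: ch.
  exact: exprn_continuous.
by apply: continuousD; [exact: (sq _ cRe)|exact: (sq _ cIm)].
Qed.

Lemma schwartz_normc_bounded (f : 'rV[R]_n -> R[i]) : schwartz f ->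
  exists M, forall x, normc (f x) <= M.
Proof.
move=> [/real_schwartz_bounded[M1 h1] /real_schwartz_bounded[M2 h2]].
exists (M1 + M2) => x; apply: le_trans (lerD (h1 x) (h2 x)).
by case: (f x) => u v; exact: normc_le.
Qed.

(** Real and imaginary parts are estimated separately, at the cost of the factor 2. *)
Lemma normc_Cintegral_le d (X : measurableType d) (mu : {measure set X -> \bar R})
    (D : set X) (F : X -> R[i]) (G : X -> R) : measurable D ->
  measurable_fun setT (fun u => complex.Re (F u)) ->
  measurable_fun setT (fun u => complex.Im (F u)) ->
  measurable_fun setT G -> (forall u, normc (F u) <= G u) ->
  ((normc (Cintegral mu D F))%:E <= 2%:E * \int[mu]_(u in D) (G u)%:E)%E.
Proof.
move=> mD mRe mIm mG FG.
have part (h : X -> R) : measurable_fun setT h -> (forall u, `|h u| <= G u) ->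
    (`|\int[mu]_(u in D) h u|%R%:E <= \int[mu]_(u in D) (G u)%:E)%E.
  move=> mh hG; rewrite /Rintegral.
  apply: le_trans (_ : (`|\int[mu]_(u in D) (h u)%:E| <= _)%E).
    (* The real-valued integral is [fine] of the extended one and equals 0 when that is infinite, so
       the inequality holds in every case. *)
    by case: (\int[mu]_(u in D) (h u)%:E)%E => //= *; rewrite ?normr0 ?leey.
  have mhE : measurable_fun D (fun u => (h u)%:E).
    by apply: measurable_funTS; exact/measurable_EFinP.
  apply: le_trans (le_abse_integral _ mD mhE) _.
  apply: ge0_le_integral => //.
  - exact: measurableT_comp mhE.
  - by apply: measurable_funTS; exact/measurable_EFinP.
  - by move=> u _; rewrite lee_fin.
have hRe := part _ mRe (fun u => le_trans (Re_le_normc (F u)) (FG u)).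
have hIm := part _ mIm (fun u => le_trans (Im_le_normc (F u)) (FG u)).
apply: le_trans (_ : (`|\int[mu]_(u in D) complex.Re (F u)|%R%:E +
    `|\int[mu]_(u in D) complex.Im (F u)|%R%:E <= _)%E).
  by rewrite -EFinD lee_fin; exact: normc_le.
have -> : 2%:E = (1 + 1)%E :> \bar R by rewrite -EFinD.
by rewrite ge0_muleDl// !mul1e; exact: leeD.
Qed.

Lemma normc_sphere_integral_le (f g : 'rV[R]_n -> R[i]) x t :
  schwartz f -> schwartz g ->
  ((normc (Cintegral sigma (sphere n)
    (fun u => (f (x - t *: u.1) * g (x - t *: u.2))%R)))%:E <=
   2%:E * \int[sigma]_(u in sphere n)
     (normc (f (x - t *: u.1)%R) * normc (g (x - t *: u.2)%R))%:E)%E.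
Proof.
move=> sf sg.
have [/real_schwartz_continuous cfr /real_schwartz_continuous cfi] := sf.
have [/real_schwartz_continuous cgr /real_schwartz_continuous cgi] := sg.
have mfr := measurable_fst_arg x t cfr.
have mfi := measurable_fst_arg x t cfi.
have mgr := measurable_snd_arg x t cgr.
have mgi := measurable_snd_arg x t cgi.
apply: normc_Cintegral_le.
- exact: measurable_sphere.
- rewrite (_ : (fun u => _) = (fun u : T =>
      complex.Re (f (x - t *: u.1)) * complex.Re (g (x - t *: u.2)) -
      complex.Im (f (x - t *: u.1)) * complex.Im (g (x - t *: u.2)))).
    by apply: measurable_funB; exact: measurable_funM.
  by apply/funext => u; case: (f _) => ? ?; case: (g _).
- rewrite (_ : (fun u => _) = (fun u : T =>
      complex.Re (f (x - t *: u.1)) * complex.Im (g (x - t *: u.2)) +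
      complex.Im (f (x - t *: u.1)) * complex.Re (g (x - t *: u.2)))).
    by apply: measurable_funD; exact: measurable_funM.
  by apply/funext => u; case: (f _) => ? ?; case: (g _).
- apply: measurable_funM.
    exact: measurable_fst_arg (schwartz_normc_continuous sf).
  exact: measurable_snd_arg (schwartz_normc_continuous sg).
- by move=> u; rewrite normcM.
Qed.

Lemma Lnorm_powR (h : 'rV[R]_n -> R) (q : R) : 0 < q -> (forall y, 0 <= h y) ->
  (Lnorm L q%:E (fun x => (h x)%:E) `^ q = \int[L]_x (h x `^ q)%:E)%E.
Proof.
move=> q0 h0; rewrite (poweR_Lnorm L (fun x => (h x)%:E) (lt0r_neq0 q0)).
by apply: eq_integral => y _; rewrite /= ger0_norm.
Qed.

Lemma Lnorm_eq0_continuous (h : 'rV[R]_n -> R) (p : \bar R) : (0 < p)%E ->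
  continuous h -> (forall y, 0 <= h y) ->
  Lnorm L p (fun x => (h x)%:E) = 0%E -> forall y, h y = 0.
Proof.
move=> p0 ch h0 hp0 y; apply/eqP; rewrite eq_le h0 andbT.
apply: continuous_ae_le => //.
have mh : measurable_fun setT (fun x => (h x)%:E).
  by apply/measurable_EFinP; exact: continuous_measurable_rV.
have := Lnorm_eq0_eq0 mh p0 hp0.
apply: filterS => x /(_ I)/= [->]; exact: lexx.
Qed.

Lemma le_Lnormy (h : 'rV[R]_n -> R) (beta : R) : continuous h ->
  (forall y, 0 <= h y) ->
  Lnorm L +oo%E (fun x => (h x)%:E) = beta%:E -> forall y, h y <= beta.
Proof.
move=> ch h0; rewrite unlock /Lnorm.
(* The norm at [+oo] is defined by cases on whether the space has positive measure; the unit cube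
   decides it. *)
have -> : (0 < L setT)%E.
  apply: lt_le_trans (_ : L (cube 0 1) <= _)%E.
    by rewrite lebesgue_cube// lte_fin exprn_gt0.
  by apply: le_measure; rewrite ?inE//; exact: measurable_cube.
move=> hbeta; apply: continuous_ae_le => //.
have := ess_sup_ge L (abse \o (fun x => (h x)%:E)); rewrite hbeta.
by apply: filterS => x /=; rewrite lee_fin ger0_norm.
Qed.

End complex_functions.

(** * The spherical maximal function of two Schwartz functions *)

Section spherical_maximal.
Context {R : realType} (n : nat).
Hypothesis n2 : (2 <= n)%N.
Local Notation L := (@lebesgue_rV R n).
Local Notation T := ('rV[R]_n * 'rV[R]_n)%type.
Local Notation sigma := (@surface_measure R n).
Local Notation K := (@average_const R n).
Variables f g : 'rV[R]_n -> R[i].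
Hypotheses (sf : schwartz f) (sg : schwartz g).

Definition spherical_averages (x : 'rV[R]_n) : set R :=
  [set normc (Cintegral sigma (sphere n)
     (fun u => f (x - t *: u.1) * g (x - t *: u.2))) | t in `]0, +oo[].

Let a x := normc (f x).
Let b x := normc (g x).
Let ca : continuous a := schwartz_normc_continuous sf.
Let cb : continuous b := schwartz_normc_continuous sg.
Let a0 x : 0 <= a x. Proof. exact: normc_ge0. Qed.
Let b0 x : 0 <= b x. Proof. exact: normc_ge0. Qed.

Lemma spherical_maximalE : spherical_maximal f g =
  fun x => ereal_sup [set e%:E | e in spherical_averages x].
Proof.
apply/funext => x; congr ereal_sup; apply/seteqP; split=> [_ [t t0 <-]|_ [_ [t t0 <-] <-]].
  by exists (normc (Cintegral sigma (sphere n)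
    (fun u => f (x - t *: u.1) * g (x - t *: u.2)))) => //; exists t.
by exists t.
Qed.

Lemma spherical_averages_neq0 x : spherical_averages x !=set0.
Proof. by eexists; exists 1 => //=; rewrite in_itv/= ltr01. Qed.

Lemma spherical_averagesP x e : spherical_averages x e -> 0 <= e /\
  exists2 t, 0 < t & (e%:E <= 2%:E *
    \int[sigma]_(u in sphere n) (a (x - t *: u.1)%R * b (x - t *: u.2)%R)%:E)%E.
Proof.
move=> [t tpos <-]; split; first exact: normc_ge0.
have t0 : 0 < t by move: tpos; rewrite /= in_itv/= andbT.
by exists t => //; exact: normc_sphere_integral_le.
Qed.

(** Once [|g|] is replaced by [beta], an average of [|f|] alone remains, and the first marginal is
    enough. *)
Lemma spherical_averages_le_fst x e beta : (forall y, b y <= beta) ->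
  spherical_averages x e ->
  0 <= e /\ exists N, e <= 2 * beta * K * rat_maximal a N x.
Proof.
move=> bbeta /spherical_averagesP[e0 [t t0 et]]; split => //.
have beta0 : 0 <= beta := le_trans (b0 0) (bbeta 0).
have [Ma aM] := schwartz_normc_bounded sf.
have [N xN] := sphere_average_fst_maximal x n2 ca a0 aM t0.
have ma := measurable_fst_arg x t ca.
have mb := measurable_snd_arg x t cb.
exists N; rewrite -lee_fin; apply: le_trans et _.
rewrite (_ : 2 * beta * K * _ = 2 * (beta * (K * rat_maximal a N x))); last by rewrite !mulrA.
rewrite [leRHS]EFinM lee_wpmul2l// [leRHS]EFinM.
apply: le_trans (lee_wpmul2l _ xN); last by rewrite lee_fin.
rewrite -ge0_integralZl_EFin//; first last.
- exact/measurable_funTS/measurable_EFinP.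
- by move=> u _; rewrite lee_fin.
- exact: measurable_sphere.
apply: ge0_le_integral => //.
- exact: measurable_sphere.
- by move=> u _; rewrite lee_fin mulr_ge0.
- by apply/measurable_funTS/measurable_EFinP; exact: measurable_funM.
- by apply: measurable_funeM; exact/measurable_funTS/measurable_EFinP.
- by move=> u _; rewrite -EFinM lee_fin mulrC ler_wpM2r.
Qed.

Lemma spherical_averages_le_snd x e alpha : (forall y, a y <= alpha) ->
  spherical_averages x e ->
  0 <= e /\ exists N, e <= 2 * alpha * K * rat_maximal b N x.
Proof.
move=> aalpha /spherical_averagesP[e0 [t t0 et]]; split => //.
have alpha0 : 0 <= alpha := le_trans (a0 0) (aalpha 0).
have [Mb bM] := schwartz_normc_bounded sg.
have [N xN] := sphere_average_snd_maximal x n2 cb b0 bM t0.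
have ma := measurable_fst_arg x t ca.
have mb := measurable_snd_arg x t cb.
exists N; rewrite -lee_fin; apply: le_trans et _.
rewrite (_ : 2 * alpha * K * _ = 2 * (alpha * (K * rat_maximal b N x))); last by rewrite !mulrA.
rewrite [leRHS]EFinM lee_wpmul2l// [leRHS]EFinM.
apply: le_trans (lee_wpmul2l _ xN); last by rewrite lee_fin.
rewrite -ge0_integralZl_EFin//; first last.
- exact/measurable_funTS/measurable_EFinP.
- by move=> u _; rewrite lee_fin.
- exact: measurable_sphere.
apply: ge0_le_integral => //.
- exact: measurable_sphere.
- by move=> u _; rewrite lee_fin mulr_ge0.
- by apply/measurable_funTS/measurable_EFinP; exact: measurable_funM.
- by apply: measurable_funeM; exact/measurable_funTS/measurable_EFinP.
- by move=> u _; rewrite -EFinM lee_fin ler_wpM2r.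
Qed.

(** Settles the case of a vanishing norm, where dividing by [alpha] or [beta] is impossible. *)
Lemma spherical_maximal_eq0 :
  (forall y, a y = 0) \/ (forall y, b y = 0) -> spherical_maximal f g = cst 0%E.
Proof.
move=> ab0; rewrite spherical_maximalE; apply/funext => x /=.
have e_eq0 e : spherical_averages x e -> e = 0.
  move=> /spherical_averagesP[e0 [t _ et]]; apply/eqP; rewrite eq_le e0 andbT.
  rewrite -lee_fin; apply: le_trans et _; rewrite integral0_eq ?mule0//.
  by move=> u _; case: ab0 => ->; rewrite ?mul0r ?mulr0.
have [e Se] := spherical_averages_neq0 x.
apply/eqP; rewrite eq_le; apply/andP; split.
  by apply: ge_ereal_sup => _ [e' Se' <-]; rewrite (e_eq0 _ Se').
by apply: ereal_sup_ubound; exists e => //; rewrite (e_eq0 _ Se).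
Qed.

Lemma surface_measure_sphere_fin : (sigma (sphere n) < +oo)%E.
Proof.
rewrite /surface_measure/= lte_mul_pinfty ?lee_fin//.
apply: lebesgue2_punctured_ball_fin; last exact: subIsetr.
apply: measurableI; last exact: measurable_punctured_ball.
by rewrite -[X in measurable X]setTI; apply: measurable_sphere_proj => //; exact: measurable_sphere.
Qed.

Lemma Lnormy_spherical_maximal_le alpha beta :
  (forall y, a y <= alpha) -> (forall y, b y <= beta) ->
  (Lnorm L +oo%E (spherical_maximal f g) <=
    (2 * fine (sigma (sphere n)) * alpha * beta)%:E)%E.
Proof.
move=> aalpha bbeta.
have alpha0 : 0 <= alpha := le_trans (a0 0) (aalpha 0).
have beta0 : 0 <= beta := le_trans (b0 0) (bbeta 0).
have s0 : 0 <= fine (sigma (sphere n)) by exact: fine_ge0.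
have c0 : 0 <= 2 * fine (sigma (sphere n)) * alpha * beta.
  by apply: mulr_ge0 => //; apply: mulr_ge0 => //; exact: mulr_ge0.
rewrite unlock /Lnorm; case: ifPn => _; last by rewrite lee_fin.
apply/ess_supP/nearW => x /=.
rewrite spherical_maximalE gee0_abs; last first.
  have [e Se] := spherical_averages_neq0 x.
  apply: (@le_trans _ _ e%:E); first by rewrite lee_fin; have [] := spherical_averagesP Se.
  by apply: ereal_sup_ubound; exists e.
apply: ge_ereal_sup => _ [e /spherical_averagesP[_ [t t0 et]] <-].
apply: le_trans et _.
rewrite (_ : 2 * _ * _ * _ = 2 * (fine (sigma (sphere n)) * (alpha * beta))); last first.
  by rewrite !mulrA.
rewrite [leRHS]EFinM lee_wpmul2l//.
apply: (@le_trans _ _ (\int[sigma]_(u in sphere n) cst (alpha * beta)%:E u)%E).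
  apply: ge0_le_integral => //.
  - exact: measurable_sphere.
  - by move=> u _; rewrite lee_fin mulr_ge0.
  - apply/measurable_funTS/measurable_EFinP; apply: measurable_funM.
      exact: measurable_fst_arg.
    exact: measurable_snd_arg.
  - by move=> u _; rewrite lee_fin ler_pM.
rewrite integral_cst; last exact: measurable_sphere.
have sE : sigma (sphere n) = (fine (sigma (sphere n)))%:E.
  by rewrite fineK// ge0_fin_numE//; exact: surface_measure_sphere_fin.
by rewrite [X in (_ * X <= _)%E]sE -EFinM mulrC.
Qed.

End spherical_maximal.

(** * The estimate for each range of exponents *)

Section bounds.
Context {R : realType} (n : nat).
Local Notation L := (@lebesgue_rV R n).
Local Notation K := (@average_const R n).

(** The estimate for finite positive norms, the range in which the functions can be normalized;
    [bilinear_boundP] lifts the restriction. *)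
Definition bilinear_bound (p1 p2 p : \bar R) (C : R) : Prop :=
  forall (f g : 'rV[R]_n -> R[i]) (alpha beta : R), schwartz f -> schwartz g ->
    CLnorm L p1 f = alpha%:E -> CLnorm L p2 g = beta%:E ->
    0 < alpha -> 0 < beta ->
    (Lnorm L p (spherical_maximal f g) <= (C * alpha * beta)%:E)%E.

Lemma CLnorm_powR (f : 'rV[R]_n -> R[i]) (q alpha : R) : 0 < q ->
  CLnorm L q%:E f = alpha%:E ->
  (\int[L]_x (normc (f x) `^ q)%:E = (alpha `^ q)%:E)%E.
Proof.
move=> q0 fa; rewrite -(Lnorm_powR q0 (fun x => normc_ge0 (f x))).
by move: fa; rewrite /CLnorm => ->; rewrite poweR_EFin.
Qed.

Lemma bilinear_bound_fin (q q1 q2 : R) : (2 <= n)%N ->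
  1 < q -> 1 < q1 -> 1 < q2 -> q1^-1 + q2^-1 = q^-1 ->
  bilinear_bound q1%:E q2%:E q%:E (4 * K * (2 * Lp_const n q) `^ q^-1).
Proof.
move=> n2 q_1 q1_1 q2_1 q12 f g alpha beta sf sg fa gb alpha0 beta0.
have [Ma aM] := schwartz_normc_bounded sf.
have [Mb bM] := schwartz_normc_bounded sg.
rewrite spherical_maximalE.
apply: (Lnorm_sup_bilinear_le n2 q_1 q1_1 q2_1 q12 (schwartz_normc_continuous sf)
  (fun x => normc_ge0 (f x)) aM (schwartz_normc_continuous sg)
  (fun x => normc_ge0 (g x)) bM alpha0 beta0).
- by apply: CLnorm_powR => //; lra.
- by apply: CLnorm_powR => //; lra.
- exact: spherical_averages_neq0.
- by move=> x e; exact: spherical_averagesP.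
Qed.

Lemma bilinear_bound_fin_oo (q : R) : (2 <= n)%N -> 1 < q ->
  bilinear_bound q%:E +oo%E q%:E (2 * K * Lp_const n q `^ q^-1).
Proof.
move=> n2 q_1 f g alpha beta sf sg fa gb alpha0 beta0.
have [Ma aM] := schwartz_normc_bounded sf.
have bbeta := le_Lnormy (schwartz_normc_continuous sg) (fun x => normc_ge0 (g x)) gb.
rewrite spherical_maximalE.
have -> : 2 * K * Lp_const n q `^ q^-1 * alpha * beta =
    2 * beta * K * Lp_const n q `^ q^-1 * alpha by ring.
apply: (Lnorm_sup_rat_maximal_le q_1 _ (ltW alpha0) (schwartz_normc_continuous sf)
  (fun x => normc_ge0 (f x)) aM).
- by apply: mulr_ge0; [apply: mulr_ge0 => //; exact: ltW|exact: average_const_ge0].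
- exact: spherical_averages_neq0.
- by move=> x e; exact: spherical_averages_le_fst.
- by apply: CLnorm_powR => //; lra.
Qed.

Lemma bilinear_bound_oo_fin (q : R) : (2 <= n)%N -> 1 < q ->
  bilinear_bound +oo%E q%:E q%:E (2 * K * Lp_const n q `^ q^-1).
Proof.
move=> n2 q_1 f g alpha beta sf sg fa gb alpha0 beta0.
have [Mb bM] := schwartz_normc_bounded sg.
have aalpha := le_Lnormy (schwartz_normc_continuous sf) (fun x => normc_ge0 (f x)) fa.
rewrite spherical_maximalE.
have -> : 2 * K * Lp_const n q `^ q^-1 * alpha * beta =
    2 * alpha * K * Lp_const n q `^ q^-1 * beta by ring.
apply: (Lnorm_sup_rat_maximal_le q_1 _ (ltW beta0) (schwartz_normc_continuous sg)
  (fun x => normc_ge0 (g x)) bM).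
- by apply: mulr_ge0; [apply: mulr_ge0 => //; exact: ltW|exact: average_const_ge0].
- exact: spherical_averages_neq0.
- by move=> x e; exact: spherical_averages_le_snd.
- by apply: CLnorm_powR => //; lra.
Qed.

Lemma bilinear_bound_oo :
  bilinear_bound +oo%E +oo%E +oo%E (2 * fine (@surface_measure R n (sphere n))).
Proof.
move=> f g alpha beta sf sg fa gb alpha0 beta0.
apply: Lnormy_spherical_maximal_le => //.
  exact: le_Lnormy (schwartz_normc_continuous sf) (fun x => normc_ge0 (f x)) fa.
exact: le_Lnormy (schwartz_normc_continuous sg) (fun x => normc_ge0 (g x)) gb.
Qed.

(** A zero norm forces the function to vanish by continuity, and then the maximal function vanishes
    too. If neither norm is zero and one is infinite, the right side is [+oo]; this needs a strictly
    positive constant, because [0 * +oo = 0], hence the added 1. *)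
Lemma bilinear_boundP (p1 p2 p : \bar R) (C : R) : (0 < p1)%E -> (0 < p2)%E -> (0 < p)%E ->
  bilinear_bound p1 p2 p C -> forall f g : 'rV[R]_n -> R[i], schwartz f -> schwartz g ->
  (Lnorm L p (spherical_maximal f g) <=
    (`|C| + 1)%:E * CLnorm L p1 f * CLnorm L p2 g)%E.
Proof.
move=> p10 p20 p0 boundC f g sf sg.
have C10 : 0 < `|C| + 1 by rewrite ltr_wpDl.
have norm_gt0 (h : 'rV[R]_n -> R[i]) (q : \bar R) : (0 < q)%E -> schwartz h ->
    (forall y, normc (h y) = 0) \/ (0 < CLnorm L q h)%E.
  move=> q0 sh; have [h0|h0] := eqVneq (CLnorm L q h) 0%E; last first.
    by right; rewrite lt0e h0 Lnorm_ge0.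
  left; apply: Lnorm_eq0_continuous q0 _ _ h0; first exact: schwartz_normc_continuous.
  by move=> y; exact: normc_ge0.
have rhs0 : (0 <= (`|C| + 1)%:E * CLnorm L p1 f * CLnorm L p2 g)%E.
  by rewrite mule_ge0 ?Lnorm_ge0// mule_ge0 ?Lnorm_ge0// lee_fin ltW.
have lhs0 : spherical_maximal f g = cst 0%E ->
    (Lnorm L p (spherical_maximal f g) <=
      (`|C| + 1)%:E * CLnorm L p1 f * CLnorm L p2 g)%E.
  by move=> ->; rewrite Lnorm0// gt_eqF.
have [f0|f_gt0] := norm_gt0 f p1 p10 sf.
  by apply: lhs0; apply: spherical_maximal_eq0 => //; left.
have [g0|g_gt0] := norm_gt0 g p2 p20 sg.
  by apply: lhs0; apply: spherical_maximal_eq0 => //; right.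
case fa : (CLnorm L p1 f) f_gt0 => [alpha| |]//; last first.
  by move=> _; rewrite gt0_muley ?lte_fin// gt0_mulye// leey.
rewrite lte_fin => alpha0.
case gb : (CLnorm L p2 g) g_gt0 => [beta| |]//; last first.
  by move=> _; rewrite gt0_muley ?leey// -EFinM lte_fin mulr_gt0.
rewrite lte_fin => beta0.
apply: le_trans (boundC f g alpha beta sf sg fa gb alpha0 beta0) _.
rewrite -!EFinM lee_fin ler_wpM2r ?(ltW beta0)// ler_wpM2r ?(ltW alpha0)//.
by apply: le_trans (ler_norm C) _; rewrite lerDl.
Qed.

End bounds.

Theorem proposition2 (R : realType) (n : nat) (p1 p2 p : \bar R)
  (hn : (2 <= n)%N)
  (hp1 : (1 < p1)%E) (hp2 : (1 < p2)%E) (hp : (1 < p)%E)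
  (hpp : (p1^-1 + p2^-1 = p^-1)%E) :
  exists C : R, forall f g : 'rV[R]_n -> R[i], schwartz f -> schwartz g ->
    (Lnorm (lebesgue_rV n) p (spherical_maximal f g) <=
      C%:E * CLnorm (lebesgue_rV n) p1 f * CLnorm (lebesgue_rV n) p2 g)%E.
Proof.
suff [C boundC] : exists C, @bilinear_bound R n p1 p2 p C.
  have gt0 (q : \bar R) : (1 < q)%E -> (0 < q)%E by apply: lt_trans.
  by exists (`|C| + 1); apply: bilinear_boundP boundC; exact: gt0.
have inve_fin (q : R) : (1 < q%:E)%E -> (q%:E^-1 = (q^-1)%:E)%E.
  by rewrite lte_fin => q1; rewrite inver gt_eqF//; lra.
(* Of the eight combinations of finite and infinite exponents, four are compatible with the relation
   between the reciprocals; each of the others equates 0 with a positive real. *)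
case: p1 hp1 hpp => [q1| |]//; case: p2 hp2 => [q2| |]//; case: p hp => [q| |]//;
  move=> hp hp2 hp1; rewrite ?inve_fin// ?invey ?adde0 ?add0e.
- rewrite -EFinD => -[q12]; move: hp hp2 hp1; rewrite !lte_fin => hp hp2 hp1.
  by eexists; exact: bilinear_bound_fin hn hp hp1 hp2 q12.
- move=> [] /eqP; rewrite gt_eqF//; move: hp1 hp2; rewrite !lte_fin => hp1 hp2.
  by rewrite addr_gt0// invr_gt0; lra.
- move=> [/invr_inj <-]; eexists; apply: bilinear_bound_fin_oo => //.
- move=> [] /eqP; rewrite gt_eqF// invr_gt0; move: hp1; rewrite lte_fin; lra.
- move=> [/invr_inj <-]; eexists; apply: bilinear_bound_oo_fin => //.
- move=> [] /eqP; rewrite gt_eqF// invr_gt0; move: hp2; rewrite lte_fin; lra.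
- move=> [] /eqP; rewrite lt_eqF// invr_gt0; move: hp; rewrite lte_fin; lra.
- by move=> _; eexists; exact: bilinear_bound_oo.
Qed.
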